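(* Let $p\ge 2$, $D>0$, $r>0$. The local Rademacher complexity of the class $H_p=H_{p,D,M}$ satisfies $$R_r(H_p)\le\sqrt{\frac{2}{n}\sum_{j=1}^\infty\min\Big(r,\;D^2M^{\frac{2}{p^*}-1}\lambda_j\Big)}.$$
   Context: Let $M,n\ge 1$ be integers and let $\mathcal{H}_1,\dots,\mathcal{H}_M$ be (reproducing kernel) Hilbert spaces. Put $\mathcal{H}=\mathcal{H}_1\times\cdots\times\mathcal{H}_M$ with the inner product $\langle \boldsymbol{u},\boldsymbol{v}\rangle=\sum_m\langle \boldsymbol{u}^{(m)},\boldsymbol{v}^{(m)}\rangle$. Let $\boldsymbol{x}=(\boldsymbol{x}^{(1)},\dots,\boldsymbol{x}^{(M)})$ be a random element of $\mathcal{H}$ (the image of a random input under the kernel feature maps) with $\mathbb{E}\|\boldsymbol{x}\|^2<\infty$; its law is denoted $P$. Let $\boldsymbol{x}_1,\dots,\boldsymbol{x}_n$ be i.i.d. copies of $\boldsymbol{x}$, and $\sigma_1,\dots,\sigma_n$ i.i.d. Rademacher signs independent of them. For $\boldsymbol{w}=(\boldsymbol{w}^{(1)},\dots,\boldsymbol{w}^{(M)})\in\mathcal{H}$ let $\|\boldsymbol{w}\|_{2,p}=\big\|(\|\boldsymbol{w}^{(m)}\|_{\mathcal{H}_m})_{m=1}^M\big\|_p$, the $\ell_p$-norm of the vector of block norms, and $f_{\boldsymbol{w}}(\boldsymbol{x})=\langle\boldsymbol{w},\boldsymbol{x}\rangle$. The class is $H_{p,D,M}=\{f_{\boldsymbol{w}}:\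 \|\boldsymbol{w}\|_{2,p}\le D\}$. With $Pf_{\boldsymbol{w}}^2=\mathbb{E}(f_{\boldsymbol{w}}(\boldsymbol{x}))^2$, the local Rademacher complexity is $$R_r(H_p)=\mathbb{E}\sup_{f_{\boldsymbol{w}}\in H_p:\,Pf_{\boldsymbol{w}}^2\le r}\Big\langle\boldsymbol{w},\frac1n\sum_{i=1}^n\sigma_i\boldsymbol{x}_i\Big\rangle .$$ $(\lambda_j)_{j\ge1}$ are the eigenvalues (with multiplicity) of the uncentered covariance operator $J=\mathbb{E}\,\boldsymbol{x}\otimes\boldsymbol{x}$ on $\mathcal{H}$, where $(\boldsymbol{x}\otimes\boldsymbol{x})\boldsymbol{u}=\langle\boldsymbol{x},\boldsymbol{u}\rangle\boldsymbol{x}$. $p^*$ is the conjugate exponent of $p$: $1/p+1/p^*=1$. *)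

(* Defs.v *)
From HB Require Import structures.
From mathcomp Require Import all_boot all_order all_algebra.
From mathcomp Require Import all_classical all_reals all_analysis.
From mathcomp Require Import ring.

Set Implicit Arguments.
Unset Strict Implicit.
Unset Printing Implicit Defensive.
Import Order.TTheory GRing.Theory Num.Theory.
Import numFieldNormedType.Exports.
Local Open Scope classical_set_scope.
Local Open Scope ring_scope.

HB.mixin Record CompleteNormedModule_isHilbert (R : realType) V
    & CompleteNormedModule R V := {
  inner : V -> V -> R ;
  innerC : forall u v, inner u v = inner v u ;
  innerDl : forall u v w, inner (u + v) w = inner u w + inner v w ;
  innerZl : forall (a : R) u v, inner (a *: u) v = a * inner u v ;
  inner_normE : forall u, inner u u = `|u| ^+ 2
}.

#[short(type="hilbertType")]
HB.structure Definition Hilbert (R : realType) :=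
  {V of CompleteNormedModule R V & CompleteNormedModule_isHilbert R V}.

(* The Hilbert product of a finite family. It is an alias of the dependent
   function space, so that `u m` is the m-th block of u. *)
Definition hprod (R : realType) (I : finType) (H : I -> hilbertType R) : Type :=
  forall m, H m.

Section hprod_hilbert.
Context (R : realType) (I : finType) (H : I -> hilbertType R).
Local Notation V := (hprod H).
Implicit Types (u v w : V) (a : R).

HB.instance Definition _ := gen_eqMixin V.
HB.instance Definition _ := gen_choiceMixin V.

Definition hprod_zero : V := fun m => 0.
Definition hprod_add u v : V := fun m => u m + v m.
Definition hprod_opp u : V := fun m => - u m.
Definition hprod_scale a u : V := fun m => a *: u m.

Let extE u v : (forall m, u m = v m) -> u = v.
Proof. by move=> uv; exact: functional_extensionality_dep. Qed.

Let addA : associative hprod_add.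
Proof. by move=> u v w; apply: extE => m; rewrite /hprod_add addrA. Qed.
Let addC : commutative hprod_add.
Proof. by move=> u v; apply: extE => m; rewrite /hprod_add addrC. Qed.
Let add0 : left_id hprod_zero hprod_add.
Proof. by move=> u; apply: extE => m; rewrite /hprod_add add0r. Qed.
Let addN : left_inverse hprod_zero hprod_opp hprod_add.
Proof. by move=> u; apply: extE => m; rewrite /hprod_add addNr. Qed.

HB.instance Definition _ := GRing.isZmodule.Build V addA addC add0 addN.

Let scaleA a b u : hprod_scale a (hprod_scale b u) = hprod_scale (a * b) u.
Proof. by apply: extE => m; rewrite /hprod_scale scalerA. Qed.
Let scale1 : left_id 1 hprod_scale.
Proof. by move=> u; apply: extE => m; rewrite /hprod_scale scale1r. Qed.
Let scaleDr : right_distributive hprod_scale +%R.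
Proof. by move=> a u v; apply: extE => m; rewrite /hprod_scale scalerDr. Qed.
Let scaleDl v : {morph hprod_scale^~ v : a b / a + b}.
Proof. by move=> a b; apply: extE => m; rewrite /hprod_scale scalerDl. Qed.

HB.instance Definition _ :=
  GRing.Zmodule_isLmodule.Build R V scaleA scale1 scaleDr scaleDl.

Definition hprod_inner u v : R := \sum_m inner (u m) (v m).

Definition hprod_norm u : R := Num.sqrt (hprod_inner u u).

Let ipC u v : hprod_inner u v = hprod_inner v u.
Proof. by apply: eq_bigr => m _; rewrite innerC. Qed.
Let ipDl u v w : hprod_inner (u + v) w = hprod_inner u w + hprod_inner v w.
Proof. by rewrite -big_split; apply: eq_bigr => m _ /=; rewrite -innerDl. Qed.
Let ipZl a u v : hprod_inner (a *: u) v = a * hprod_inner u v.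
Proof. by rewrite mulr_sumr; apply: eq_bigr => m _; rewrite -innerZl. Qed.
Let ipDr u v w : hprod_inner w (u + v) = hprod_inner w u + hprod_inner w v.
Proof. by rewrite ipC ipDl !(ipC w). Qed.
Let ipZr a u v : hprod_inner v (a *: u) = a * hprod_inner v u.
Proof. by rewrite ipC ipZl (ipC v). Qed.
Let ip_normE u : hprod_inner u u = \sum_m `|u m| ^+ 2.
Proof. by apply: eq_bigr => m _; rewrite inner_normE. Qed.
Let ip_ge0 u : 0 <= hprod_inner u u.
Proof. by rewrite ip_normE sumr_ge0. Qed.

Let cauchy_schwarz u v :
  hprod_inner u v ^+ 2 <= hprod_inner u u * hprod_inner v v.
Proof.
have [v0|v0] := eqVneq (hprod_inner v v) 0.
  have {}v0 m : v m = 0.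
    move: v0; rewrite ip_normE => /psumr_eq0P v0.
    apply/eqP; rewrite -normr_eq0 -sqrf_eq0.
    by apply/eqP/v0 => // j _; exact: sqr_ge0.
  rewrite [X in X ^+ 2]big1 ?expr0n ?mulr_ge0// => m _.
  by rewrite v0 innerC -(scale0r (0 : H m)) innerZl mul0r.
have vp : 0 < hprod_inner v v by rewrite lt_def v0 ip_ge0.
have := ip_ge0 (hprod_inner v v *: u + (- hprod_inner u v) *: v).
rewrite ipDl !ipDr !ipZl !ipZr (ipC v u) => h.
rewrite -subr_ge0 -(pmulr_rge0 _ vp); apply: le_trans h _.
by rewrite le_eqVlt; apply/orP; left; apply/eqP; ring.
Qed.

Let normD u v : hprod_norm (u + v) <= hprod_norm u + hprod_norm v.
Proof.
rewrite /hprod_norm -(ler_pXn2r (n := 2)) ?nnegrE ?addr_ge0 ?sqrtr_ge0//.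
rewrite sqr_sqrtr// sqrrD !sqr_sqrtr// ipDl !ipDr (ipC v u).
rewrite -subr_ge0.
suff h : hprod_inner u v <=
    Num.sqrt (hprod_inner u u) * Num.sqrt (hprod_inner v v).
  move: h; rewrite -subr_ge0 => h; rewrite (_ : _ - _ =
    (Num.sqrt (hprod_inner u u) * Num.sqrt (hprod_inner v v)
      - hprod_inner u v) *+ 2) ?mulrn_wge0// mulr2n; ring.
rewrite -sqrtrM//; apply: le_trans (ler_norm _) _.
by rewrite -sqrtr_sqr ler_wsqrtr// cauchy_schwarz.
Qed.

Let normZ a u : hprod_norm (a *: u) = `|a| * hprod_norm u.
Proof.
by rewrite /hprod_norm ipZl ipZr mulrA -expr2 sqrtrM ?sqr_ge0// sqrtr_sqr.
Qed.

Let le_norm u m : `|u m| <= hprod_norm u.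
Proof.
rewrite -(ler_pXn2r (n := 2)) ?nnegrE ?sqrtr_ge0//.
rewrite sqr_sqrtr// ip_normE (bigD1 m)//= lerDl.
by apply: sumr_ge0 => j _; exact: sqr_ge0.
Qed.

Let norm_le u : hprod_norm u <= \sum_m `|u m|.
Proof.
rewrite -(ler_pXn2r (n := 2)) ?nnegrE ?sqrtr_ge0 ?sumr_ge0//.
rewrite sqr_sqrtr// ip_normE expr2 mulr_suml; apply: ler_sum => m _.
rewrite expr2; apply: ler_wpM2l => //.
by rewrite (bigD1 m)//= lerDl; apply: sumr_ge0.
Qed.

Let norm_eq0 u : hprod_norm u = 0 -> u = 0.
Proof.
move=> u0; apply: extE => m; apply/eqP.
by rewrite -normr_le0 -u0 le_norm.
Qed.

HB.instance Definition _ := Lmodule_isNormed.Build R V normD normZ norm_eq0.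

Let complete (F : set_system V) : ProperFilter F -> cauchy F -> cvg F.
Proof.
move=> FF /cauchyP Fc.
have cvgF m : cvg ((fun u : V => u m) @ F).
  apply/cauchy_cvgP/cauchyP => e e0.
  have [u Fu] := Fc _ e0; exists (u m).
  apply: (@filterS _ F _ (ball u e)) Fu => v; rewrite -!ball_normE/=.
  exact: le_lt_trans (le_norm (u - v) m).
pose l : V := fun m => lim ((fun u : V => u m) @ F).
apply: (cvgP l); apply/cvgrPdist_lt => e e0.
have eI0 : 0 < e / #|I|.+1%:R by rewrite divr_gt0.
have : \forall u \near F, forall m, `|l m - u m| < e / #|I|.+1%:R.
  apply: filter_forall => m.
  by move/cvgrPdist_lt : (cvgF m); apply.
apply: filterS => u lu; apply: le_lt_trans (norm_le _) _.
apply: (@le_lt_trans _ _ (\sum_(m : I) e / #|I|.+1%:R)).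
  by apply: ler_sum => m _; exact/ltW/lu.
rewrite sumr_const -[ltLHS]mulr_natr -mulrA gtr_pMr// mulrC.
by rewrite ltr_pdivrMr// mul1r ltr_nat.
Qed.

HB.instance Definition _ := Uniform_isComplete.Build V complete.

Let ip_hnormE u : hprod_inner u u = `|u| ^+ 2.
Proof. by rewrite [`|u|]/(hprod_norm u) sqr_sqrtr. Qed.

HB.instance Definition _ := CompleteNormedModule_isHilbert.Build R V
  ipC ipDl ipZl ip_hnormE.

End hprod_hilbert.

Definition borel (T : topologicalType) : set (set T) := <<s @open T >>.

Section random_elements.
Context d (Omega : measurableType d) (R : realType) (P : probability Omega R).

(* Strong measurability: Borel measurable with an essentially separable range.
   On a separable space the second condition is automatic. *)
Definition random_element (T : topologicalType) (X : Omega -> T) : Prop :=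
  (forall B, borel B -> measurable (X @^-1` B)) /\
  (exists2 D : set T, countable D & {ae P, forall omega, closure D (X omega)}).

Definition identically_distributed (T : topologicalType) (X Y : Omega -> T) :=
  forall B : set T, borel B -> P (X @^-1` B) = P (Y @^-1` B).

Definition rademacher (s : Omega -> R) : Prop :=
  P (s @^-1` [set 1]) = 2^-1%:E /\ P (s @^-1` [set - 1]) = 2^-1%:E.

Definition mutually_independent (I : finType) (F : I -> set (set Omega)) :=
  forall (J : {set I}) (A : I -> set Omega), (forall i, i \in J -> F i (A i)) ->
    P (\bigcap_(i in [set` J]) A i) = (\prod_(i in J) P (A i))%E.

(* The n elements X_i and the n real variables s_i, all 2n of them together. *)
Definition independent_sample_signs (T : topologicalType) (n : nat)
    (X : 'I_n -> Omega -> T) (s : 'I_n -> Omega -> R) : Prop :=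
  mutually_independent (fun k : 'I_n + 'I_n =>
    match k with
    | inl i => preimage_set_system setT (X i) (@borel T)
    | inr i => preimage_set_system setT (s i) measurable
    end).

End random_elements.

Section covariance_operator.
Context (R : realType) (V : hilbertType R).

Definition tensor (u v : V) : V -> V := fun w => inner v w *: u.

(* J = E (x (x) x); the expectation of operators is taken in the weak sense,
   <J u, v> = E <(x (x) x) u, v>, which determines J. *)
Definition covariance_operator d (Omega : measurableType d)
    (P : probability Omega R) (x : Omega -> V) (J : V -> V) : Prop :=
  forall u v, ((inner (J u) v)%:E =
    'E_P[fun omega => inner (tensor (x omega) (x omega) u) v])%E.

(* The eigenspace ker (J - mu) has dimension k; uniqueness of the coordinates
   of the vector 0 gives the linear independence of b. *)
Definition eigenvalue_multiplicity (J : V -> V) (mu : R) (k : nat) : Prop :=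
  exists b : 'I_k -> V, (forall i, J (b i) = mu *: b i) /\
    forall v, J v = mu *: v ->
      exists! c : 'rV[R]_k, v = \sum_(i < k) c ord0 i *: b i.

(* lambda enumerates the nonzero eigenvalues of J, each repeated according to
   its multiplicity. Zero terms are unconstrained: they pad the sequence when
   J has only finitely many nonzero eigenvalues. *)
Definition eigenvalue_sequence (J : V -> V) (lambda : nat -> R) : Prop :=
  forall mu, mu != 0 -> exists k,
    ([set j | lambda j = mu] #= `I_k)%card /\ eigenvalue_multiplicity J mu k.

End covariance_operator.

Section local_rademacher_complexity.
Context (R : realType).

Definition linear_function (V : hilbertType R) (w : V) : V -> R :=
  fun u => inner w u.

Definition local_rademacher d (Omega : measurableType d)
    (P : probability Omega R) (V : hilbertType R) (x : Omega -> V) (n : nat)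
    (xs : 'I_n -> Omega -> V) (s : 'I_n -> Omega -> R)
    (F : set (V -> R)) (r : R) : \bar R :=
  (\int[P]_omega ereal_sup
    [set (inner w (n%:R^-1 *: \sum_(i < n) s i omega *: xs i omega)%R)%:E |
      w in [set w | F (linear_function w) /\
        'E_P[fun omega' => (linear_function w (x omega') ^+ 2)%R] <= r%:E]])%E.

Definition lp_norm (I : finType) (p : \bar R) (a : I -> R) : R :=
  match p with
  | p%:E => (\sum_m `|a m| `^ p) `^ p^-1
  | +oo%E => \big[Num.max/0]_m `|a m|
  | -oo%E => 0
  end.

Definition mixed_norm (I : finType) (H : I -> hilbertType R) (p : \bar R)
    (w : hprod H) : R := lp_norm p (fun m => `|w m|).

Definition mkl_class (I : finType) (H : I -> hilbertType R) (p : \bar R)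
    (D : R) : set (hprod H -> R) :=
  [set linear_function w | w in [set w : hprod H | mixed_norm p w <= D]].

End local_rademacher_complexity.

(* Main.v *)
(* On the class, |w|^2 <= C := D^2 M^(2/p* - 1) by the power mean inequality,
   so only the Hilbert norm and the quadratic form E <w, x>^2 = <J w, w> matter.
   Let (e_j, mu_j) be an orthonormal eigenbasis of J on the closure of its
   range. With S = (1/n) sum_i sigma_i x_i, a termwise AM-GM inequality
   against the weights mu_j / r + 1 / C, which satisfy
   sum_j (mu_j / r + 1 / C) <w, e_j>^2 <= 2, gives for every c > 0
     <w, S> <= c / 2 + (1 / c) sum_j min (r / mu_j, C) <S, e_j>^2,
   uniformly in w. Independence gives E <S, e_j>^2 = mu_j / n, and optimizing
   over c concludes. To stay with finite sums, the expansion is truncated at N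
   and the remainder S - Pi_N S is paid for by the term C |S - Pi_N S|^2, whose
   expectation tends to 0.

   The spectral theorem is obtained without weak compactness. If K is positive
   and dominated by J, with mu = sup_(|v| = 1) <K v, v>, then (K / mu)^k v is
   always a Cauchy sequence, whose limit is fixed by K / mu. Were all limits 0,
   dominated convergence would give E |(K / mu)^k x|^2 -> 0; but this
   expectation is at least <K A v, A v> for A = (K / mu)^k and any unit v, hence
   at least mu. Deflating by the eigenvectors so found exhausts J. *)
Require Import Defs.
From HB Require Import structures.
From mathcomp Require Import all_boot all_order all_algebra.
From mathcomp Require Import all_classical all_reals all_analysis.
From mathcomp Require Import measurable_realfun ring lra.

Set Implicit Arguments.
Unset Strict Implicit.
Unset Printing Implicit Defensive.
Import Order.TTheory GRing.Theory Num.Theory.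
Import numFieldNormedType.Exports.
Local Open Scope classical_set_scope.
Local Open Scope ring_scope.

(** * Hilbert spaces *)

Section hilbert.
Context (R : realType) (V : hilbertType R).
Implicit Types (u v w : V) (a : R) (K A : V -> V).

Lemma innerDr u v w : inner w (u + v) = inner w u + inner w v.
Proof. by rewrite innerC innerDl !(innerC w). Qed.

Lemma innerZr a u v : inner v (a *: u) = a * inner v u.
Proof. by rewrite innerC innerZl (innerC v). Qed.

Lemma inner0l u : inner 0 u = 0 :> R.
Proof. by rewrite -(scale0r (0 : V)) innerZl mul0r. Qed.

Lemma inner0r u : inner u 0 = 0 :> R.
Proof. by rewrite innerC inner0l. Qed.

Lemma innerNl u v : inner (- u) v = - inner u v.
Proof. by rewrite -scaleN1r innerZl mulN1r. Qed.

Lemma innerNr u v : inner u (- v) = - inner u v.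
Proof. by rewrite innerC innerNl innerC. Qed.

Lemma innerBl u v w : inner (u - v) w = inner u w - inner v w.
Proof. by rewrite innerDl innerNl. Qed.

Lemma innerBr u v w : inner w (u - v) = inner w u - inner w v.
Proof. by rewrite innerDr innerNr. Qed.

Lemma inner_suml (I : Type) (s : seq I) (P : pred I) (F : I -> V) v :
  inner (\sum_(i <- s | P i) F i) v = \sum_(i <- s | P i) inner (F i) v.
Proof.
by apply: (big_morph (fun u => inner u v)) => [u w|]; [exact: innerDl|exact: inner0l].
Qed.

Lemma inner_sumr (I : Type) (s : seq I) (P : pred I) (F : I -> V) v :
  inner v (\sum_(i <- s | P i) F i) = \sum_(i <- s | P i) inner v (F i).
Proof. by rewrite innerC inner_suml; apply: eq_bigr => i _; rewrite innerC. Qed.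

Lemma inner_ge0 u : 0 <= inner u u :> R.
Proof. by rewrite inner_normE sqr_ge0. Qed.

Lemma inner_inj u v : (forall w, inner u w = inner v w) -> u = v.
Proof.
move=> uv; apply/eqP; rewrite -subr_eq0 -normr_eq0 -sqrf_eq0 -inner_normE.
by rewrite innerBl uv subrr.
Qed.

Lemma normB_sqr u v : `|u - v| ^+ 2 = `|u| ^+ 2 - 2 * inner u v + `|v| ^+ 2.
Proof. rewrite -!inner_normE innerBl !innerBr (innerC v u); ring. Qed.

Definition self_adjoint K := forall u v, inner (K u) v = inner u (K v).
Definition positive K := forall u, 0 <= inner (K u) u.

(** Operators are bare maps. Symmetry alone forces linearity, because inner products against all
    vectors separate points. *)
Lemma self_adjointD K u v : self_adjoint K -> K (u + v) = K u + K v.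
Proof. by move=> Ks; apply: inner_inj => w; rewrite Ks !innerDl !Ks. Qed.

Lemma self_adjointZ K a u : self_adjoint K -> K (a *: u) = a *: K u.
Proof. by move=> Ks; apply: inner_inj => w; rewrite Ks !innerZl !Ks. Qed.

Lemma self_adjointB K u v : self_adjoint K -> K (u - v) = K u - K v.
Proof. by move=> Ks; apply: inner_inj => w; rewrite Ks !innerBl !Ks. Qed.

(** The form of [K] at [u - t *: v] is a nonnegative quadratic polynomial in [t]; its value at the
    minimizer [a / b] is the inequality. *)
Lemma positive_cauchy_schwarz K u v : self_adjoint K -> positive K ->
  inner (K u) v ^+ 2 <= inner (K u) u * inner (K v) v.
Proof.
move=> Ks Kp; set a := inner (K u) v; set c := inner (K u) u.
set b := inner (K v) v.
have h t : 0 <= c - 2 * t * a + t ^+ 2 * b.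
  have := Kp (u - t *: v); rewrite self_adjointB// self_adjointZ//.
  rewrite !innerBl !innerBr !innerZl !innerZr (Ks v u) (innerC v) -/a -/b -/c.
  by move=> h; apply: le_trans h _; rewrite le_eqVlt; apply/orP; left; apply/eqP; ring.
have [b0|b0] := eqVneq b 0.
  have [->|a0] := eqVneq a 0; first by rewrite expr0n/= mulr_ge0// ?Kp.
  (* With [b = 0] the polynomial is affine in [t], and this [t] brings it down to [-1]. *)
  have := h ((c + 1) / (2 * a)).
  have -> : 2 * ((c + 1) / (2 * a)) * a = c + 1 by field.
  rewrite b0; lra.
have bp : 0 < b by rewrite lt_def b0 Kp.
have := h (a / b).
have -> : c - 2 * (a / b) * a + (a / b) ^+ 2 * b = (c * b - a ^+ 2) / b by field.
by rewrite pmulr_lge0 ?invr_gt0// subr_ge0.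
Qed.

Lemma cauchy_schwarz u v : inner u v ^+ 2 <= `|u| ^+ 2 * `|v| ^+ 2.
Proof.
by rewrite -!inner_normE; apply: (@positive_cauchy_schwarz id) => // w; exact: inner_ge0.
Qed.

Lemma normr_inner_le u v : `|inner u v| <= `|u| * `|v|.
Proof.
rewrite -(ler_pXn2r (n := 2)) ?nnegrE ?mulr_ge0//.
by rewrite real_normK ?num_real// exprMn cauchy_schwarz.
Qed.

Lemma lipschitz_continuous (W : normedModType R) (f : V -> W) (c : R) :
  (forall u v, `|f u - f v| <= c * `|u - v|) -> continuous f.
Proof.
move=> fc u; apply/cvgrPdist_lt => e e0; near=> v.
apply: le_lt_trans (fc _ _) _.
have : `|u - v| < e / (`|c| + 1).
  near: v; have c0 : 0 < e / (`|c| + 1) by rewrite divr_gt0// ltr_wpDl.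
  by move: (@cvg_id _ (nbhs u)) => /cvgrPdist_lt /(_ _ c0).
rewrite ltr_pdivlMr ?ltr_wpDl// mulrC; apply: le_lt_trans.
by apply: ler_wpM2r => //; have := ler_norm c; lra.
Unshelve. all: by end_near. Qed.

Lemma inner_continuous u : continuous (fun v => inner v u : R).
Proof.
apply: (@lipschitz_continuous _ _ `|u|) => v w.
by rewrite -innerBl mulrC; exact: normr_inner_le.
Qed.

(* For the iterates of a positive contraction and for the remainders of an
   orthogonal expansion, [b] is the decreasing sequence of squared norms. *)
Lemma cvg_energy (u : nat -> V) (b : nat -> R) : (forall k, 0 <= b k) ->
  (forall k l, (k <= l)%N -> `|u k - u l| ^+ 2 <= b k - b l) -> cvgn u.
Proof.
move=> b0 ub.
have bd : nonincreasing_seq b.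
  by move=> k l kl; rewrite -subr_ge0; apply: le_trans (ub _ _ kl); exact: sqr_ge0.
have bl : has_lbound (range b) by exists 0 => _ [k _ <-].
have cb : cvgn b by exact: nonincreasing_is_cvgn.
apply/cauchy_cvgP/cauchyP => e e0.
have e20 : 0 < e ^+ 2 by rewrite exprn_gt0.
move: (cb) => /cvgrPdist_lt /(_ _ e20) [N _ bN].
exists (u N); exists N => // k /= Nk.
rewrite -ball_normE/= -(ltr_pXn2r (n := 2)) ?nnegrE ?(ltW e0)//.
apply: le_lt_trans (ub _ _ Nk) _.
have := bN N (leqnn N); rewrite distrC; apply: le_lt_trans.
apply: le_trans (ler_norm _); rewrite lerD2l lerN2.
exact: nonincreasing_cvgn_ge.
Qed.

End hilbert.

(** * Spectral decomposition *)

Section power_iteration.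
Context (R : realType) (V : hilbertType R) (A : V -> V).
Hypotheses (As : self_adjoint A) (Ap : positive A).
Hypothesis A1 : forall v, inner (A v) v <= `|v| ^+ 2.
Implicit Types (u v : V).

Lemma iter_self_adjoint k : self_adjoint (iter k A).
Proof. by elim: k => // k IH u v; rewrite iterS iterSr As IH. Qed.

Lemma iter_inner k l v : inner (iter k A v) (iter l A v) = inner (iter (k + l) A v) v.
Proof. by rewrite addnC iterD (iter_self_adjoint l) //. Qed.

(** In operator terms, [A^2 <= A]: Cauchy-Schwarz for the form of [A] at [v] and [A v], then
    [A <= 1] at [A v], and one factor [|A v|^2] cancels. *)
Lemma normr_contraction_sqr v : `|A v| ^+ 2 <= inner (A v) v.
Proof.
have [->|Av0] := eqVneq (A v) 0; first by rewrite inner0l normr0 expr0n.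
have h : 0 < `|A v| ^+ 2 by rewrite exprn_gt0// normr_gt0.
rewrite -(ler_pM2r h) -expr2 -[X in X ^+ 2]inner_normE.
apply: le_trans (positive_cauchy_schwarz v (A v) As Ap) _.
by apply: ler_wpM2l => //; exact: A1.
Qed.

Lemma normr_contraction v : `|A v| <= `|v|.
Proof.
rewrite -(ler_pXn2r (n := 2)) ?nnegrE//.
exact: le_trans (normr_contraction_sqr v) (A1 v).
Qed.

Lemma normr_iter k v : `|iter k A v| <= `|v|.
Proof. by elim: k => // k; apply: le_trans; exact: normr_contraction. Qed.

Lemma iter_continuous k : continuous (iter k A).
Proof.
apply: (@lipschitz_continuous _ _ _ _ 1) => u v.
rewrite -self_adjointB; last exact: iter_self_adjoint.
by rewrite mul1r normr_iter.
Qed.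

Lemma iter_inner_even k v : inner (iter k.*2 A v) v = `|iter k A v| ^+ 2.
Proof. by rewrite -addnn -iter_inner inner_normE. Qed.

Lemma iter_inner_odd k v : inner (iter k.*2.+1 A v) v =
  inner (A (iter k A v)) (iter k A v).
Proof. by rewrite -iterS iter_inner addSn addnn. Qed.

(** An even power gives a squared norm, an odd one the form of [A] at the half power. *)
Lemma iter_positive k : positive (iter k A).
Proof.
move=> v; rewrite -(odd_double_half k); case: (odd k); rewrite ?add1n ?add0n.
  by rewrite iter_inner_odd.
by rewrite iter_inner_even sqr_ge0.
Qed.

(** The same parity split: the step from an even power uses [A <= 1], the step from an odd one
    [A^2 <= A]. *)
Lemma iter_inner_decr k v : inner (iter k.+1 A v) v <= inner (iter k A v) v.
Proof.
rewrite -(odd_double_half k); case: (odd k); rewrite ?add1n ?add0n.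
  by rewrite -doubleS iter_inner_even iter_inner_odd normr_contraction_sqr.
by rewrite iter_inner_odd iter_inner_even A1.
Qed.

Lemma iter_inner_nonincr v : nonincreasing_seq (fun k => inner (iter k A v) v).
Proof. by apply/nonincreasing_seqP => k; exact: iter_inner_decr. Qed.

(** Positivity of [A^k] at [v - A v]: the moments [<A^k v, v>] are convex in [k]. *)
Lemma iter_inner_convex k v :
  inner (iter k.+1 A v) v - inner (iter k.+2 A v) v <=
  inner (iter k A v) v - inner (iter k.+1 A v) v.
Proof.
have := iter_positive k (v - A v).
rewrite (self_adjointB _ _ (iter_self_adjoint k)) innerBl !innerBr -!iterSr.
rewrite -[A v]/(iter 1 A v) !iter_inner !addn1; lra.
Qed.

(** By convexity no decrement of the moments exceeds the first. So a vector that nearly maximizes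
    the form stays nearly maximal under iteration. *)
Lemma iter_inner_bernoulli k v :
  inner v v - inner (iter k A v) v <= k%:R * (inner v v - inner (A v) v).
Proof.
have h j : inner (iter j A v) v - inner (iter j.+1 A v) v <=
    inner v v - inner (A v) v.
  by elim: j => // j; apply: le_trans; exact: iter_inner_convex.
by elim: k => [|k IH]; [rewrite mul0r subrr|rewrite -natr1; have := h k; lra].
Qed.

(** The cross term is the moment of order [k + l], which is at least the one of order [2 l]. *)
Lemma iter_dist k l v : (k <= l)%N ->
  `|iter k A v - iter l A v| ^+ 2 <= `|iter k A v| ^+ 2 - `|iter l A v| ^+ 2.
Proof.
move=> kl; rewrite normB_sqr iter_inner -!iter_inner_even.
have := @iter_inner_nonincr v (k + l) l.*2.
by rewrite -addnn leq_add2r kl => /(_ isT); rewrite addnn; lra.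
Qed.

Lemma power_iteration v : exists u, A u = u /\
  (fun k => `|iter k A v| ^+ 2) @ \oo --> `|u| ^+ 2.
Proof.
have /cvg_ex[u vu] : cvgn (fun k => iter k A v).
  apply: (@cvg_energy _ _ _ (fun k => `|iter k A v| ^+ 2)) => [k|k l kl].
    exact: sqr_ge0.
  exact: iter_dist.
exists u; split; last first.
  by under eq_fun do rewrite expr2; rewrite expr2; apply: cvgM; exact: cvg_norm vu.
(* The shifted iterates converge to [u] and, by continuity, to [A u]. *)
have c1 : (fun k => iter k.+1 A v) @ \oo --> u.
  by have := vu; rewrite -cvg_shiftS.
have c2 : (fun k => iter k.+1 A v) @ \oo --> A u.
  by apply: (continuous_cvg _ _ vu); exact: (@iter_continuous 1).
exact: (cvg_unique _ c2 c1).
Qed.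

End power_iteration.

(** * Existence of a top eigenvector for an operator dominated by the covariance *)

Section top_eigenvector.
Context d (Omega : measurableType d) (R : realType) (P : probability Omega R).
Context (V : hilbertType R) (x : Omega -> V).
Hypothesis xm : forall f : V -> R, continuous f -> measurable_fun setT (f \o x).
Hypothesis x2 : P.-integrable setT (fun omega => (`|x omega| ^+ 2)%:E).

Lemma continuous_sqrf (f : V -> R) : continuous f -> continuous (fun v => f v ^+ 2).
Proof.
move=> cf; have -> : (fun v => f v ^+ 2) = f \* f.
  by apply/funext => v; rewrite expr2.
by move=> v; apply: continuousM; exact: cf.
Qed.

Lemma measurable_sqr_inner v :
  measurable_fun setT (fun omega => (inner v (x omega) ^+ 2 : R)%:E).
Proof.
apply/measurable_EFinP; under eq_fun do rewrite innerC.
exact: (xm (continuous_sqrf (@inner_continuous _ _ v))).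
Qed.

(** Domination of [K] by the second moments of [x] stands in for compactness: it lets pointwise
    decay of the iterates become decay of an expectation, which near-maximizers of the form
    forbid. *)
Lemma top_eigenvector (K : V -> V) : self_adjoint K -> positive K ->
  (forall v, (inner (K v) v)%:E <= \int[P]_omega (inner v (x omega) ^+ 2)%:E)%E ->
  (exists v, inner (K v) v != 0) ->
  exists u (mu : R), [/\ `|u| = 1, 0 < mu, K u = mu *: u &
    forall v, inner (K v) v <= mu * `|v| ^+ 2].
Proof.
move=> Ks Kp Kx [v0 Kv0].
pose T := fine (\int[P]_omega (`|x omega| ^+ 2)%:E).
have TE : (T%:E = \int[P]_omega (`|x omega| ^+ 2)%:E)%E.
  by rewrite fineK//; exact: integrable_fin_num.
have KT v : inner (K v) v <= `|v| ^+ 2 * T.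
  rewrite -lee_fin EFinM TE; apply: le_trans (Kx v) _.
  rewrite -ge0_integralZl//=; last exact: (measurable_int P x2).
  apply: ge0_le_integral => //=.
  - by move=> *; rewrite lee_fin sqr_ge0.
  - exact: measurable_sqr_inner.
  - by apply: measurable_funeM; exact: (measurable_int P x2).
  - by move=> w _; rewrite -EFinM lee_fin cauchy_schwarz.
pose S := [set inner (K v) v | v in [set v | `|v| = 1]].
have normal (v : V) : v != 0 -> `| `|v|^-1 *: v| = 1.
  move=> v0'; rewrite normrZ ger0_norm ?invr_ge0//.
  by rewrite mulVf// normr_eq0.
have Knormal v : v != 0 -> inner (K v) v =
    inner (K (`|v|^-1 *: v)) (`|v|^-1 *: v) * `|v| ^+ 2.
  move=> v0'; rewrite self_adjointZ// innerZl innerZr; field.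
  by rewrite normr_eq0.
have S_ub : has_ubound S.
  by exists T => _ [v /= v1 <-]; have := KT v; rewrite v1 expr1n mul1r.
have v0n0 : v0 != 0.
  by apply: contraNneq Kv0 => ->; rewrite inner0r.
pose mu := sup S.
have Smu v : `|v| = 1 -> inner (K v) v <= mu.
  by move=> v1; apply: ub_le_sup => //; exists v.
have mu0 : 0 < mu.
  apply: lt_le_trans (Smu _ (normal _ v0n0)).
  rewrite lt_def Kp andbT; apply: contraNneq Kv0 => h.
  by rewrite Knormal// h mul0r.
have Kmu v : inner (K v) v <= mu * `|v| ^+ 2.
  have [->|vn0] := eqVneq v 0; first by rewrite inner0r normr0 expr0n mulr0.
  by rewrite Knormal// ler_wpM2r// Smu// normal.
pose A v := mu^-1 *: K v.
have As : self_adjoint A by move=> u v; rewrite innerZl innerZr Ks.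
have Ap : positive A by move=> u; rewrite innerZl mulr_ge0// ?invr_ge0 ?ltW.
have A1 v : inner (A v) v <= `|v| ^+ 2.
  by rewrite innerZl mulrC ler_pdivrMr// mulrC.
have KA v : K v = mu *: A v by rewrite scalerA mulfV ?scale1r// gt_eqF.
suff [u [u0 Au]] : exists u, u != 0 /\ A u = u.
  exists (`|u|^-1 *: u), mu; split => //; first exact: normal.
  by rewrite self_adjointZ// KA Au !scalerA mulrC.
(* Without a fixed vector every limit of the power iteration is 0, so [E |A^k x|^2] tends to 0; yet
   each of these expectations is at least [mu]. *)
apply: contrapT => noeig.
have A0 v : (fun k => `|iter k A v| ^+ 2) @ \oo --> (0 : R).
  have [u [Au]] := power_iteration As Ap A1 v.
  have [->|u0] := eqVneq u 0; first by rewrite normr0 expr0n.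
  by exfalso; apply: noeig; exists u.
pose f k omega := (`|iter k A (x omega)| ^+ 2)%:E.
have mf k : measurable_fun setT (f k).
  apply/measurable_EFinP.
  apply: (xm (f := fun v => `|iter k A v| ^+ 2)); apply: continuous_sqrf => v.
  by apply: continuous_comp; [exact: iter_continuous|exact: norm_continuous].
have fcvg : {ae P, forall omega, setT omega -> f ^~ omega @ \oo --> cst 0%E omega}.
  by apply: aeW => omega _ /=; apply: cvg_EFin; [exact: nearW|exact: A0].
have fle : {ae P, forall omega k, setT omega -> (`|f k omega| <= (`|x omega| ^+ 2)%:E)%E}.
  apply: aeW => omega k _; rewrite lee_fin ger0_norm ?sqr_ge0//.
  by rewrite ler_pXn2r ?nnegrE// normr_iter.
have [_ _] := dominated_convergence measurableT mf (measurable_cst _) fcvg x2 fle.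
rewrite integral_cst// mul0e => f0.
suff /(lime_ge (cvgP _ f0)) : \forall k \near \oo, (mu%:E <= \int[P]_omega f k omega)%E.
  by rewrite (cvg_lim _ f0)// lee_fin leNgt mu0.
apply: nearW => k; apply/lee_addgt0Pr => e e0.
(* The power [A^(2k+1)] multiplies the defect of [v] by at most [2k+1]; a defect below [e / c] costs
   at most [e] once scaled by [mu]. *)
pose c : R := mu * k.*2.+1%:R.
have c0 : 0 < c by rewrite mulr_gt0.
have [_ [v /= v1 <-]] : exists2 y, S y & mu - mu * (e / c) < y.
  by apply: sup_adherent; [rewrite mulr_gt0// divr_gt0|
     split=> //; exists (inner (K (`|v0|^-1 *: v0)) (`|v0|^-1 *: v0));
     exists (`|v0|^-1 *: v0) => //; exact: normal].
rewrite KA innerZl => Av.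
have {Av} Av : 1 - inner (A v) v < e / c.
  rewrite -(ltr_pM2l mu0); lra.
rewrite -leeBlDr//; apply: (@le_trans _ _ (inner (K (iter k A v)) (iter k A v))%:E).
  rewrite lee_fin KA innerZl -iter_inner_odd//.
  have := iter_inner_bernoulli As Ap k.*2.+1 v.
  rewrite inner_normE v1 expr1n => h.
  have {}h : 1 - inner (iter k.*2.+1 A v) v <= k.*2.+1%:R * (e / c).
    by apply: le_trans h _; rewrite ler_wpM2l// ltW.
  have {}h := ler_wpM2l (ltW mu0) h.
  have : mu * (k.*2.+1%:R * (e / c)) = e.
    by rewrite (mulrA mu) -/c mulrCA mulfV ?mulr1// gt_eqF.
  lra.
(* Pointwise [<A^k v, x>^2 = <v, A^k x>^2 <= |A^k x|^2], as [v] is a unit vector. *)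
apply: le_trans (Kx _) _; apply: ge0_le_integral => //=.
- by move=> *; rewrite lee_fin sqr_ge0.
- exact: measurable_sqr_inner.
- move=> w _; rewrite lee_fin iter_self_adjoint//.
  by apply: le_trans (cauchy_schwarz _ _) _; rewrite v1 expr1n mul1r.
Qed.

End top_eigenvector.

(** * Eigenvectors by successive deflation *)

Section deflation.
Context d (Omega : measurableType d) (R : realType) (P : probability Omega R).
Context (V : hilbertType R) (x : Omega -> V).
Hypothesis xm : forall f : V -> R, continuous f -> measurable_fun setT (f \o x).
Hypothesis x2 : P.-integrable setT (fun omega => (`|x omega| ^+ 2)%:E).
Implicit Types K : V -> V.

Let admissible K := [/\ self_adjoint K, positive K &
  forall v, ((inner (K v) v)%:E <= \int[P]_omega (inner v (x omega) ^+ 2)%:E)%E].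

(** The pair holds an eigenvector and its eigenvalue; the first alternative serves a [K] whose form
    vanishes. *)
Let top K (p : V * R) := [/\ (p.2 = 0 /\ p.1 = 0) \/ (0 < p.2 /\ `|p.1| = 1),
  K p.1 = p.2 *: p.1 & forall v, inner (K v) v <= p.2 * `|v| ^+ 2].

(** Admissibility stands inside the existential so that [choice] gives a selector defined on all
    maps. *)
Let top_exists K : exists p, admissible K -> top K p.
Proof.
have [adK|nad] := pselect (admissible K); last by exists (0, 0) => /nad.
have [Ks Kp Kx] := adK.
have [Kn0|K0] := pselect (exists v, inner (K v) v != 0); last first.
  exists (0, 0) => _; split => /= [||v]; first by left.
    by have := self_adjointZ 0 0 Ks; rewrite !scale0r.
  by rewrite mul0r leNgt; apply/negP => Kv; apply: K0; exists v; rewrite gt_eqF.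
have [u [mu [u1 mu0 Ku Kmu]]] := top_eigenvector xm x2 Ks Kp Kx Kn0.
by exists (u, mu) => _; split=> //; right.
Qed.

(* The pairs [mu j = 0], [e j = 0] pad the sequence once the deflated operator
   vanishes. *)
Lemma spectral_sequence (J : V -> V) : self_adjoint J ->
  (forall v, (inner (J v) v)%:E = \int[P]_omega (inner v (x omega) ^+ 2)%:E)%E ->
  exists (e : nat -> V) (mu : nat -> R),
    [/\ forall i j, i != j -> inner (e i) (e j) = 0,
        forall j, (mu j = 0 /\ e j = 0) \/ (0 < mu j /\ `|e j| = 1),
        forall j, J (e j) = mu j *: e j &
        forall N v, (forall j, (j < N)%N -> inner v (e j) = 0) ->
          inner (J v) v <= mu N * `|v| ^+ 2].
Proof.
move=> Js Jx.
have Jp : positive J.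
  by move=> v; rewrite -lee_fin Jx; apply: integral_ge0 => *; rewrite lee_fin sqr_ge0.
have [T TP] := choice top_exists.
pose deflate K v := K v - (T K).2 *: (inner v (T K).1 *: (T K).1).
pose K N := iter N deflate J.
have Kdef k w : K k.+1 w = K k w - (T (K k)).2 *: (inner w (T (K k)).1 *: (T (K k)).1).
  by [].
have adK N : admissible (K N).
  elim: N => [|N adN]; first by split=> // v; rewrite Jx.
  have [Ks Kp Kx] := adN; have [T01 Tu _] := TP _ adN.
  have KE v : inner (K N.+1 v) v =
      inner (K N v) v - (T (K N)).2 * inner v (T (K N)).1 ^+ 2.
    by rewrite Kdef innerBl !innerZl (innerC (T (K N)).1 v) expr2.
  have T0 : 0 <= (T (K N)).2 by case: T01 => [[->]|[/ltW]].
  split=> [u v|v|v].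
  - rewrite !Kdef innerBl innerBr !innerZl !innerZr Ks (innerC (T (K N)).1 v); ring.
  - rewrite KE subr_ge0; case: T01 => [[-> _]|[mu0 u1]]; first by rewrite mul0r.
    (* At the top eigenvector this reads [mu^2 <v, e>^2 <= mu <K v, v>]; one factor [mu] cancels. *)
    have := positive_cauchy_schwarz (T (K N)).1 v Ks Kp.
    rewrite Tu !innerZl inner_normE u1 expr1n mulr1 exprMn expr2 -mulrA ler_pM2l//.
    by rewrite (innerC v (T (K N)).1).
  - apply: le_trans (Kx v); rewrite lee_fin KE gerBl.
    by rewrite mulr_ge0// sqr_ge0.
pose e N := (T (K N)).1; pose mu N := (T (K N)).2.
have T01 N : (mu N = 0 /\ e N = 0) \/ (0 < mu N /\ `|e N| = 1).
  by have [] := TP _ (adK N).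
have Ke N : K N (e N) = mu N *: e N by have [] := TP _ (adK N).
(* Deflation keeps the kernel: if [K w = 0] then [mu <e, w> = <K e, w> = <e, K w> = 0], so the
   subtracted term vanishes. *)
have KN0 N w : K N w = 0 -> K N.+1 w = 0.
  move=> Kw; rewrite Kdef Kw sub0r -/(e N) -/(mu N) scalerA.
  have [Ks _ _] := adK N.
  by rewrite innerC -innerZl -Ke Ks Kw inner0r scale0r oppr0.
have Kkill N j : (j < N)%N -> K N (e j) = 0.
  elim: N => // N IH; rewrite ltnS leq_eqVlt => /predU1P[->|/IH /KN0//].
  rewrite Kdef -/(e N) -/(mu N) Ke; case: (T01 N) => [[-> _]|[_ e1]].
    by rewrite !scale0r subrr.
  by rewrite inner_normE e1 expr1n scale1r subrr.
(* [mu_i <e_i, e_j> = <e_i, K_i e_j>], and [K_i] annihilates every earlier [e_j]. *)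
have e_lt i j : (j < i)%N -> inner (e i) (e j) = 0.
  move=> ji; have [Ks _ _] := adK i.
  case: (T01 i) => [[_ ->]|[mu0 _]]; first by rewrite inner0l.
  apply/eqP; rewrite -(inj_eq (mulfI (lt0r_neq0 mu0))) mulr0.
  by rewrite -innerZl -Ke Ks Kkill// inner0r.
(* Orthogonally to the first [N] vectors nothing has been subtracted, so eigenvectors and bounds
   obtained there for [K N] are valid for [J]. *)
have JK N w : (forall j, (j < N)%N -> inner w (e j) = 0) -> J w = K N w.
  elim: N => // N IH we; rewrite Kdef -/(e N) we// scale0r scaler0 subr0.
  by apply: IH => j jN; apply: we; exact: ltnW.
exists e, mu; split => //.
- move=> i j; rewrite neq_ltn => /orP[|]; last exact: e_lt.
  by rewrite innerC; exact: e_lt.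
- by move=> j; rewrite (JK j) => [|i ij]; [exact: Ke|exact: e_lt].
- by move=> N v ve; rewrite (JK N)//; have [] := TP _ (adK N).
Qed.

End deflation.

(** * Expansions along an orthogonal sequence of unit or zero vectors *)

Section orthogonal_expansion.
Context (R : realType) (V : hilbertType R) (e : nat -> V) (mu : nat -> R) (J : V -> V).
Hypothesis e_orth : forall i j, i != j -> inner (e i) (e j) = 0.
Hypothesis e01 : forall j, e j = 0 \/ `|e j| = 1.
Implicit Types v w : V.

(** Under the hypotheses on [e], the projection onto the orthogonal complement of the first [N]
    vectors; padding by [e j = 0] changes nothing. *)
Definition remainder N v := v - \sum_(j < N) inner v (e j) *: e j.

Lemma inner_span N (c : nat -> R) j : (j < N)%N ->
  inner (\sum_(i < N) c i *: e i) (e j) = c j * `|e j| ^+ 2.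
Proof.
move=> jN; rewrite inner_suml (bigD1 (Ordinal jN))//= innerZl inner_normE big1 ?addr0//.
by move=> i ij; rewrite innerZl e_orth ?mulr0.
Qed.

Lemma inner_normr_sqr v j : inner v (e j) * `|e j| ^+ 2 = inner v (e j).
Proof. by case: (e01 j) => ->; rewrite ?inner0r ?mul0r// expr1n mulr1. Qed.

Lemma remainder_orth N v j : (j < N)%N -> inner (remainder N v) (e j) = 0.
Proof.
move=> jN; rewrite /remainder innerBl (inner_span (fun j => inner v (e j)))//.
by rewrite inner_normr_sqr subrr.
Qed.

(** [remainder l w] is orthogonal to every term subtracted from [v], because [k <= l]. *)
Lemma inner_remainder k l v w : (k <= l)%N ->
  inner (remainder k v) (remainder l w) = inner v (remainder l w).
Proof.
move=> kl; rewrite {1}/remainder innerBl inner_suml big1 ?subr0// => i _.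
by rewrite innerZl innerC [X in _ * X]innerC remainder_orth ?mulr0// (leq_trans _ kl).
Qed.

Lemma remainderC N v w : inner (remainder N v) w = inner v (remainder N w).
Proof. by rewrite innerC -(inner_remainder _ _ (leqnn N)) innerC inner_remainder. Qed.

Lemma normr_remainder N v :
  `|remainder N v| ^+ 2 = `|v| ^+ 2 - \sum_(j < N) inner v (e j) ^+ 2.
Proof.
rewrite -!inner_normE inner_remainder// /remainder innerBr inner_sumr.
by congr (_ - _); apply: eq_bigr => j _; rewrite innerZr expr2.
Qed.

Lemma normr_remainder_le N v : `|remainder N v| ^+ 2 <= `|v| ^+ 2.
Proof. by rewrite normr_remainder gerBl sumr_ge0// => j _; rewrite sqr_ge0. Qed.

Lemma remainder_dist k l v : (k <= l)%N ->
  `|remainder k v - remainder l v| ^+ 2 <= `|remainder k v| ^+ 2 - `|remainder l v| ^+ 2.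
Proof.
move=> kl; rewrite normB_sqr inner_remainder// -(inner_remainder _ _ (leqnn l)).
rewrite inner_normE; lra.
Qed.

Lemma cvg_remainder v : exists w,
  (fun N => remainder N v) @ \oo --> w /\ forall j, inner w (e j) = 0.
Proof.
have /cvg_ex[w vw] : cvgn (fun N => remainder N v).
  apply: (@cvg_energy _ _ _ (fun k => `|remainder k v| ^+ 2)) => [k|k l kl].
    exact: sqr_ge0.
  exact: remainder_dist.
exists w; split=> // j.
have : (fun N => inner (remainder N v) (e j)) @ \oo --> inner w (e j).
  exact: (continuous_cvg _ (@inner_continuous _ _ (e j) w) vw).
have : (fun N => inner (remainder N v) (e j)) @ \oo --> (0 : R).
  apply: cvg_near_cst; exists j.+1 => // N /= jN.
  by rewrite remainder_orth.
by move=> h0 hw; exact: (cvg_unique _ hw h0).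
Qed.

Lemma remainder_continuous N : continuous (remainder N).
Proof.
apply: (@lipschitz_continuous _ _ _ _ 1) => u v.
have -> : remainder N u - remainder N v = remainder N (u - v).
  apply: inner_inj => w.
  by rewrite innerBl (remainderC _ u) (remainderC _ v) (remainderC _ (u - v)) innerBl.
by rewrite mul1r -(ler_pXn2r (n := 2)) ?nnegrE// normr_remainder_le.
Qed.

Hypothesis Js : self_adjoint J.
Hypothesis Jp : positive J.
Hypothesis Je : forall j, J (e j) = mu j *: e j.

(** Bessel's inequality for the form of [J]: with [v] split into remainder [r] and projection [s],
    the eigenvector equations kill the cross terms, and [<J r, r>] is nonnegative. *)
Lemma quadratic_form_ge N v :
  \sum_(j < N) mu j * inner v (e j) ^+ 2 <= inner (J v) v.
Proof.
set r := remainder N v; set s := \sum_(j < N) inner v (e j) *: e j.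
have vE : v = r + s by rewrite /r /remainder subrK.
have JP w : inner (J s) w = \sum_(j < N) mu j * inner v (e j) * inner w (e j).
  rewrite Js inner_suml; apply: eq_bigr => j _.
  by rewrite innerZl -Js Je innerZl (innerC (e j)); ring.
have Jv : J v = J r + J s by rewrite -self_adjointD// -vE.
have Jrv : inner (J r) v = inner (J r) r + inner (J r) s by rewrite -innerDr -vE.
have Jrs : inner (J r) s = 0.
  by rewrite Js innerC JP big1// => j _; rewrite remainder_orth ?mulr0.
rewrite Jv innerDl Jrv Jrs addr0 JP.
under [X in _ + X]eq_bigr do rewrite -mulrA -expr2.
by rewrite lerDr.
Qed.

End orthogonal_expansion.

(** * Vanishing of the expected squared remainder *)

Section remainder_expectation.
Context d (Omega : measurableType d) (R : realType) (P : probability Omega R).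
Context (V : hilbertType R) (x : Omega -> V).
Hypothesis xm : forall f : V -> R, continuous f -> measurable_fun setT (f \o x).
Hypothesis x2 : P.-integrable setT (fun omega => (`|x omega| ^+ 2)%:E).
Context (J : V -> V) (e : nat -> V) (mu : nat -> R).
Hypothesis Jx :
  forall v, (inner (J v) v)%:E = (\int[P]_omega (inner v (x omega) ^+ 2)%:E)%E.
Hypothesis e_orth : forall i j, i != j -> inner (e i) (e j) = 0.
Hypothesis emu : forall j, (mu j = 0 /\ e j = 0) \/ (0 < mu j /\ `|e j| = 1).
Hypothesis Je : forall j, J (e j) = mu j *: e j.
Hypothesis J_top : forall N v, (forall j, (j < N)%N -> inner v (e j) = 0) ->
  inner (J v) v <= mu N * `|v| ^+ 2.

Let e01 j : e j = 0 \/ `|e j| = 1.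
Proof. by case: (emu j) => -[]; [left|right]. Qed.

Let mu_ge0 j : 0 <= mu j.
Proof. by case: (emu j) => [[->]|[/ltW]]. Qed.

Let muE j : (mu j)%:E = (\int[P]_omega (inner (e j) (x omega) ^+ 2)%:E)%E.
Proof.
rewrite -Jx Je innerZl inner_normE; case: (emu j) => [[-> _]|[_ ->]].
  by rewrite mul0r.
by rewrite expr1n mulr1.
Qed.

(** [mu j] is the second moment of [<e_j, x>], so Bessel's inequality bounds the sum of the [mu j]
    by [E |x|^2]. *)
Lemma eigenvalue_cvg0 : mu @ \oo --> (0 : R).
Proof.
apply: cvg_series_cvg_0; apply: nondecreasing_is_cvgn.
  by apply/nondecreasing_seqP => N; rewrite /series/= big_nat_recr//= lerDl mu_ge0.
pose T := fine (\int[P]_omega (`|x omega| ^+ 2)%:E).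
exists T => _ [N _ <-]; rewrite -lee_fin fineK; last exact: integrable_fin_num.
rewrite /series/= big_mkord -sumEFin; under eq_bigr do rewrite muE.
rewrite -(big_mkord xpredT (fun j => \int[P]_omega (inner (e j) (x omega) ^+ 2)%:E)%E).
rewrite -ge0_integral_sum//; last 2 first.
- by move=> j; exact: (measurable_sqr_inner xm).
- by move=> j w _; rewrite lee_fin sqr_ge0.
apply: ge0_le_integral => //.
- by move=> w _; apply: sume_ge0 => j _; rewrite lee_fin sqr_ge0.
- by apply: emeasurable_sum => j; exact: (measurable_sqr_inner xm).
- exact: (measurable_int P x2).
- move=> w _; rewrite sumEFin lee_fin big_mkord.
  have := sqr_ge0 `|remainder e N (x w)|; rewrite normr_remainder// subr_ge0.
  by under eq_bigr do rewrite innerC.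
Qed.

(** [J_top] applies at every [N], and [mu N] tends to 0. *)
Lemma orthogonal_quadratic_form0 v :
  (forall j, inner v (e j) = 0) -> inner (J v) v = 0.
Proof.
move=> ve; apply/eqP; rewrite eq_le; apply/andP; split; last first.
  by rewrite -lee_fin Jx integral_ge0// => w _; rewrite lee_fin sqr_ge0.
have c0 : (fun N => mu N * `|v| ^+ 2) @ \oo --> (0 : R).
  by rewrite -(mul0r (`|v| ^+ 2)); apply: cvgMl; exact: eigenvalue_cvg0.
rewrite -(cvg_lim _ c0)//; apply: (limr_ge (cvgP _ c0)); apply: nearW => N.
by apply: J_top => j _; exact: ve.
Qed.

(** Let [L v] be the limit of the remainders of [v]. For fixed [v],
    [E <L v, x>^2 = <J (L v), L v> = 0], so [<L v, x>] vanishes almost surely. Separability gives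
    one null set for a countable [D]; outside it [y = L x] is orthogonal to [D], hence to [x], while
    [|remainder N x|^2] tends to [<y, x>]. *)
Lemma remainder_ae_cvg0 :
  (exists2 D : set V, countable D & {ae P, forall omega, closure D (x omega)}) ->
  {ae P, forall omega, (fun N => `|remainder e N (x omega)| ^+ 2) @ \oo --> (0 : R)}.
Proof.
move=> [D cD xD].
have [L HL] := choice (fun v => cvg_remainder e_orth e01 v).
have Lx0 v : {ae P, forall omega, inner (L v) (x omega) = 0}.
  have [_ Lve] := HL v.
  have /ae_eq_integral_abs : (\int[P]_omega `|(inner (L v) (x omega) ^+ 2)%:E| = 0)%E.
    under eq_integral do rewrite gee0_abs ?lee_fin ?sqr_ge0//.
    by rewrite -Jx orthogonal_quadratic_form0.
  move=> /(_ measurableT (measurable_sqr_inner xm _)).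
  by apply: filterS => w /(_ I) /= [] /eqP; rewrite sqrf_eq0 => /eqP.
(* Indices outside the image of the injection are sent to 0; it only matters that [D] is covered. *)
have [g Dg] : exists g : nat -> V, D `<=` range g.
  have /countable_injP[f finj] := cD.
  have [D0|D0] := pselect (exists v, D v); last first.
    by exists (fun=> 0) => v Dv; exfalso; apply: D0; exists v.
  have : forall n, exists v, forall w, D w -> f w = n -> v = w.
    move=> n; have [[v [Dv fv]]|nv] := pselect (exists v, D v /\ f v = n).
      by exists v => w Dw fw; apply: finj; rewrite ?inE// fv fw.
    by exists 0 => w Dw fw; exfalso; apply: nv; exists w.
  by move=> /choice[g gP]; exists g => v Dv; exists (f v) => //; exact: gP.
have := ae_foralln (fun n => Lx0 (g n)).
move: xD; apply: filterS2 => w xw Lw.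
set y := L (x w).
have [xy _] := HL (x w).
have norm_y : (fun N => `|remainder e N (x w)| ^+ 2) @ \oo --> inner y (x w).
  have -> : (fun N => `|remainder e N (x w)| ^+ 2) =
      (fun N => inner (remainder e N (x w)) (x w)).
    apply/funext => N; rewrite -inner_normE inner_remainder// innerC//.
  exact: (continuous_cvg _ (@inner_continuous _ _ (x w) y) xy).
suff -> : (0 : R) = inner y (x w) by [].
(* [L] inherits self-adjointness from the remainders: [<y, g n> = <L (g n), x>]. *)
have yD v : D v -> inner v y = 0.
  move=> /Dg[n _ <-]; have [vL _] := HL (g n).
  have h1 : (fun N => inner (remainder e N (x w)) (g n)) @ \oo --> inner y (g n).
    exact: (continuous_cvg _ (@inner_continuous _ _ (g n) y) xy).
  have h2 : (fun N => inner (remainder e N (x w)) (g n)) @ \oo --> inner (L (g n)) (x w).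
    under eq_fun do rewrite remainderC// innerC.
    exact: (continuous_cvg _ (@inner_continuous _ _ (x w) (L (g n))) vL).
  by rewrite innerC -(Lw n); exact: (cvg_unique _ h1 h2).
have cl : closed [set v | inner v y = 0 :> R].
  apply: (@closed_comp _ _ (fun v => inner v y) [set 0 : R]); last exact: closed_eq.
  by move=> v _; exact: inner_continuous.
have : [set v | inner v y = 0 :> R] (x w).
  by move/closure_id : cl => ->; exact: (closure_subset yD xw).
by rewrite /= innerC => ->.
Qed.

Lemma remainder_expectation_cvg0 :
  (exists2 D : set V, countable D & {ae P, forall omega, closure D (x omega)}) ->
  (fun N => \int[P]_omega (`|remainder e N (x omega)| ^+ 2)%:E)%E @ \oo --> 0%E.
Proof.
move=> xD.
pose f N omega := (`|remainder e N (x omega)| ^+ 2)%:E : \bar R.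
have mf N : measurable_fun setT (f N).
  apply/measurable_EFinP.
  apply: (xm (f := fun v => `|remainder e N v| ^+ 2)); apply: continuous_sqrf => v.
  apply: continuous_comp; last exact: norm_continuous.
  exact: remainder_continuous.
have fcvg : {ae P, forall omega, setT omega -> f ^~ omega @ \oo --> cst 0%E omega}.
  apply: filterS (remainder_ae_cvg0 xD) => w fw _ /=.
  by apply: cvg_EFin; [exact: nearW|exact: fw].
have fle : {ae P, forall omega k, setT omega -> (`|f k omega| <= (`|x omega| ^+ 2)%:E)%E}.
  apply: aeW => omega k _; rewrite lee_fin ger0_norm ?sqr_ge0//.
  exact: normr_remainder_le.
have [_ _] := dominated_convergence measurableT mf (measurable_cst _) fcvg x2 fle.
by rewrite integral_cst// mul0e.
Qed.

End remainder_expectation.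

(** * Mixed norms *)

Section norm_comparison.
Context (R : realType).

(** The tangent at 1 of a convex power, obtained from Young's inequality for [t] and 1. *)
Lemma powR_bernoulli (t q : R) : 0 <= t -> 1 <= q -> q * t - (q - 1) <= t `^ q.
Proof.
move=> t0; rewrite le_eqVlt => /predU1P[<-|q1]; first by rewrite powRr1//; lra.
have q0 : 0 < q by lra.
have q'0 : 0 < 1 - q^-1 by rewrite subr_gt0 invf_lt1.
have := @conjugate_powR R t 1 q (1 - q^-1)^-1 t0 ler01 q0.
rewrite invr_gt0 invrK powR1 => /(_ q'0).
rewrite [X in X = _ -> _]addrC subrK => /(_ erefl).
rewrite mulr1 mul1r => h.
have := ler_wpM2l (ltW q0) h.
have -> : q * (t `^ q / q + (1 - q^-1)) = t `^ q + (q - 1) by field; rewrite gt_eqF.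
lra.
Qed.

(** The tangent bound at each [a i] divided by the mean [A]; the affine terms add up to [#|I|]. *)
Lemma power_mean (I : finType) (a : I -> R) (q : R) :
  (forall i, 0 <= a i) -> 1 <= q -> (0 < #|I|)%N ->
  #|I|%:R * ((\sum_i a i) / #|I|%:R) `^ q <= \sum_i a i `^ q.
Proof.
move=> a0 q1 I0; have N0 : 0 < #|I|%:R :> R by rewrite ltr0n.
have [S0|S0] := eqVneq (\sum_i a i) 0.
  rewrite S0 mul0r powR0 ?mulr0; first by apply: sumr_ge0 => i _; exact: powR_ge0.
  by rewrite gt_eqF//; lra.
set A := _ / _; have A0 : 0 < A by rewrite divr_gt0// lt_def S0 sumr_ge0.
have aE i : a i `^ q = (a i / A) `^ q * A `^ q.
  rewrite -powRM; [by rewrite divfK// gt_eqF|by rewrite divr_ge0// ltW|exact: ltW].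
under eq_bigr do rewrite aE; rewrite -mulr_suml ler_pM2r ?powR_gt0//.
apply: (@le_trans _ _ (\sum_i (q * (a i / A) - (q - 1)))); last first.
  by apply: ler_sum => i _; rewrite powR_bernoulli// divr_ge0// ltW.
rewrite sumrB -mulr_sumr -mulr_suml sumr_const -[_ *+ #|I|]mulr_natr.
rewrite le_eqVlt; apply/orP; left; apply/eqP; rewrite /A; field.
by rewrite S0 gt_eqF.
Qed.

Lemma normr_hprod (I : finType) (H : I -> hilbertType R) (w : hprod H) :
  `|w| ^+ 2 = \sum_m `|w m| ^+ 2.
Proof.
by rewrite -inner_normE; apply: eq_bigr => m _; rewrite inner_normE.
Qed.

(** The power mean of exponent [p / 2] on the squared block norms; conjugacy turns [1 - 2 / p] into
    [2 / pstar - 1]. For [p = +oo] the conjugate is 1 and each block norm is at most [D]. *)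
Lemma mixed_norm_bound (M : nat) (H : 'I_M -> hilbertType R) (w : hprod H)
    (p : \bar R) (pstar D : R) : (0 < M)%N -> (2%:E <= p)%E ->
  (p^-1 + (pstar%:E)^-1 = 1)%E -> mixed_norm p w <= D ->
  `|w| ^+ 2 <= D ^+ 2 * M%:R `^ (2 / pstar - 1).
Proof.
move=> M0; have N0 : 0 < M%:R :> R by rewrite ltr0n.
rewrite normr_hprod /mixed_norm inver; case: p => [p| |//].
- rewrite lee_fin => p2; rewrite inver gt_eqF; last lra.
  (* The extended inverse of 0 is [+oo], so conjugacy excludes [pstar = 0]. *)
  case: ifPn => // ps0 [ps] /= wD.
  have -> : 2 / pstar - 1 = 1 - p^-1 * 2 by lra.
  set B := \sum_m _ in wD.
  have B0 : 0 <= B by apply: sumr_ge0 => m _; exact: powR_ge0.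
  have /= := @power_mean 'I_M (fun m => `|w m| ^+ 2) (p / 2) (fun m => sqr_ge0 _).
  rewrite card_ord => /(_ _ M0) h.
  have {h} : M%:R * ((\sum_m `|w m| ^+ 2) / M%:R) `^ (p / 2) <= B.
    apply: le_trans (h _) _; first lra.
    rewrite le_eqVlt; apply/orP; left; apply/eqP; apply: eq_bigr => m _.
    rewrite normr_id -powR_mulrn// -powRrM; congr (_ `^ _); by field.
  set S := \sum_m `|w m| ^+ 2; have S0 : 0 <= S by apply: sumr_ge0 => j _; exact: sqr_ge0.
  set A := S / M%:R; have A0 : 0 <= A by rewrite divr_ge0// ltW.
  (* Raising [M A^(p/2) <= B] to the power [2/p] gives [M^(2/p) A <= D^2]. *)
  move=> MAB; have h : M%:R `^ (p^-1 * 2) * A <= D ^+ 2.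
    have -> : A = (A `^ (p / 2)) `^ (p^-1 * 2).
      rewrite -powRrM -[LHS]powRr1//; congr (_ `^ _); field; lra.
    rewrite -powRM; [|exact: ltW|exact: powR_ge0].
    apply: le_trans (ge0_ler_powR _ _ _ MAB) _.
    - by rewrite mulr_ge0// invr_ge0; lra.
    - by rewrite nnegrE mulr_ge0 ?powR_ge0// ltW.
    - by rewrite nnegrE.
    rewrite powRrM powR_mulrn ?powR_ge0// ler_pXn2r ?nnegrE ?powR_ge0//.
    exact: le_trans (powR_ge0 _ _) wD.
  rewrite powRD; last by apply/implyP => _; rewrite gt_eqF.
  rewrite powRN powRr1 ?(ltW N0)// mulrA ler_pdivlMr ?powR_gt0//.
  have -> : S = A * M%:R by rewrite divfK// gt_eqF.
  by rewrite mulrAC ler_pM2r// mulrC.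
- move=> _; rewrite invey add0e; case: ifPn => // ps0 [ps] /= wD.
  have -> : 2 / pstar - 1 = 1 by rewrite ps; lra.
  rewrite powRr1 ?(ltW N0)// mulr_natr -[in leRHS](card_ord M) -sumr_const.
  apply: ler_sum => m _; rewrite ler_pXn2r ?nnegrE//; last first.
    by apply: le_trans wD; apply: bigmax_ge_id.
  by apply: le_trans wD; rewrite -[leLHS]normr_id;
    exact: (le_bigmax _ (fun m => `| `|w m| |)).
Qed.

End norm_comparison.

(** * Eigenvalue multiplicities *)

Section multiplicity.
Context (R : realType) (V : hilbertType R) (J : V -> V).

(** The coordinates of the [u i] in the family [b] form a matrix with [k] columns. A row vector
    annihilating it gives a vanishing combination of orthonormal vectors, so the rows are free. *)
Lemma eigenvalue_multiplicity_ge (I : finType) (u : I -> V) (m : R) (k : nat) :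
  eigenvalue_multiplicity J m k -> (forall i, J (u i) = m *: u i) ->
  (forall i j, i != j -> inner (u i) (u j) = 0) -> (forall i, `|u i| = 1) ->
  (#|I| <= k)%N.
Proof.
move=> [b [bJ bC]] uJ u_orth u1.
have [c cu] := choice (fun i => let: ex_intro c (conj cE _) := bC _ (uJ i) in
  ex_intro (fun c => u i = \sum_(j < k) c ord0 j *: b j) c cE).
pose C := \matrix_(i < #|I|, j < k) c (enum_val i) ord0 j.
suff /eqP <- : row_free C by exact: rank_leq_col.
apply: inj_row_free => a aC.
have au : \sum_i a ord0 i *: u (enum_val i) = 0.
  under eq_bigr do rewrite cu scaler_sumr.
  rewrite exchange_big/= big1// => j _.
  under eq_bigr do rewrite scalerA.
  rewrite -scaler_suml; have := congr1 (fun M : 'rV_k => M ord0 j) aC.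
  rewrite !mxE; under eq_bigr do rewrite mxE; move=> ->; exact: scale0r.
apply/rowP => l; rewrite mxE.
have := congr1 (fun v => inner v (u (enum_val l))) au.
rewrite inner0l inner_suml (bigD1 l)//= innerZl inner_normE u1 expr1n mulr1.
rewrite big1 ?addr0// => i il; rewrite innerZl u_orth ?mulr0//.
by rewrite (inj_eq enum_val_inj).
Qed.

Hypothesis Jp : positive J.
Context (lambda : nat -> R).
Hypothesis lambda_eig : eigenvalue_sequence J lambda.

(** A nonzero term has a nonempty level set, hence an eigenvector [b ord0], at which positivity of
    [J] is tested. *)
Lemma eigenvalue_sequence_ge0 j : 0 <= lambda j.
Proof.
have [->//|l0] := eqVneq (lambda j) 0.
have [k [lk [b [bJ bC]]]] := lambda_eig l0.
case: k lk b bJ bC => [|k] lk b bJ bC.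
  by move: lk; rewrite II0 card_eq0 => /eqP/seteqP[/(_ j) /(_ erefl)].
(* Were this vector 0, both the zero row and a unit row would be its coordinates, against
   uniqueness. *)
have b0 : b ord0 != 0.
  apply/eqP => b0; have [c [_ cu]] := bC (b ord0) (bJ ord0).
  have h1 := cu 0; have h2 := cu (delta_mx ord0 ord0).
  have : c = (0 : 'rV[R]_k.+1).
    by apply: h1; rewrite b0 big1// => i _; rewrite mxE scale0r.
  have -> : c = delta_mx ord0 ord0.
    apply: h2; rewrite (bigD1 ord0)//= mxE !eqxx scale1r big1 ?addr0// => i i0.
    by rewrite mxE (negbTE i0) scale0r.
  move=> /matrixP /(_ ord0 ord0); rewrite !mxE !eqxx => /eqP.
  by rewrite oner_eq0.
have := Jp (b ord0); rewrite bJ innerZl inner_normE pmulr_lge0//.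
by rewrite exprn_gt0// normr_gt0.
Qed.

(** The sums are compared value by value: a nonzero [m] occurs among the [mu j] at most as often as
    its multiplicity, which is how often [lambda] takes it. The value 0 contributes nothing, as
    [f 0 = 0]. *)
Lemma orthogonal_eigenvalues_le (e : nat -> V) (mu : nat -> R) (f : R -> R) N :
  (forall i j, i != j -> inner (e i) (e j) = 0) ->
  (forall j, (mu j = 0 /\ e j = 0) \/ (0 < mu j /\ `|e j| = 1)) ->
  (forall j, J (e j) = mu j *: e j) ->
  f 0 = 0 -> (forall t, 0 <= t -> 0 <= f t) ->
  ((\sum_(j < N) f (mu j))%:E <= \sum_(0 <= j <oo) (f (lambda j))%:E)%E.
Proof.
move=> e_orth emu Je f0 f_ge0.
have fl_ge0 j : 0 <= f (lambda j) by apply: f_ge0; exact: eigenvalue_sequence_ge0.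
pose s := undup [seq mu j | j <- iota 0 N & mu j != 0].
have s0 m : m \in s -> m != 0.
  by rewrite mem_undup => /mapP[j]; rewrite mem_filter => /andP[m0 _] ->.
pose level (m : R) : seq nat := finmap.enum_fset (fset_set [set j | lambda j = m]).
have levelP m : m \in s -> (#|[pred j : 'I_N | mu j == m]| <= size (level m))%N /\
    forall j, (j \in level m) = (lambda j == m).
  move=> /s0 m0; have [k [lk mk]] := lambda_eig m0.
  have lfin : finite_set [set j | lambda j = m] by exists k.
  split; last first.
    by move=> j; rewrite [LHS](in_fset_set lfin j); apply/idP/eqP; rewrite inE.
  have -> : size (level m) = k.
    by apply/card_eq_fsetP; rewrite fset_setK.
  rewrite -[X in (X <= _)%N]card_sig.
  have mu_m (i : {j | j \in [pred j : 'I_N | mu j == m]}) : mu (val i) = m.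
    by have := valP i; rewrite inE => /eqP.
  apply: (@eigenvalue_multiplicity_ge _ (fun i => e (val (val i))) _ _ mk).
  - by move=> i; rewrite Je mu_m.
  - by move=> i j ij; apply: e_orth.
  - move=> i; case: (emu (val (val i))) => [[]|[]//].
    by rewrite mu_m => /eqP; rewrite (negbTE m0).
(* Finitely many values matter and each has a finite level, so the partial sum of the series up to
   some [K] already dominates. *)
have [K levelK] : exists K, forall m j, m \in s -> j \in level m -> (j < K)%N.
  exists (\max_(m <- s) \max_(j <- level m) j).+1 => m j ms jm.
  rewrite ltnS.
  apply: leq_trans (@leq_bigmax_seq _ s xpredT (fun m => \max_(j <- level m) j) m ms isT).
  exact: (@leq_bigmax_seq _ (level m) xpredT (fun j => j) j jm isT).
apply: le_trans (@nneseries_lim_ge _ _ xpredT 0%N K _); last first.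
  by move=> j _ _; rewrite lee_fin.
rewrite sumEFin lee_fin big_mkord.
have split_levels (T : finType) (g : T -> R) :
    \sum_i (if g i \in s then f (g i) else 0) =
    \sum_(m <- s) f m *+ #|[pred i | g i == m]|.
  transitivity (\sum_i \sum_(m <- s) (if g i == m then f m else 0)).
    apply: eq_bigr => i _; case: ifPn => gs.
      rewrite (bigD1_seq (g i)) ?undup_uniq//= eqxx big1 ?addr0// => m mg.
      by rewrite eq_sym (negbTE mg).
    rewrite big_seq big1// => m ms; case: eqP => // gm.
    by rewrite gm ms in gs.
  rewrite exchange_big/=; apply: eq_bigr => m _; rewrite -big_mkcond/= -sumr_const.
  by apply: eq_bigl => i; rewrite inE.
have -> : \sum_(j < N) f (mu j) = \sum_(j < N) (if mu j \in s then f (mu j) else 0).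
  apply: eq_bigr => j _; case: ifPn => // js; have [->//|mu0] := eqVneq (mu j) 0.
  by move: js; rewrite mem_undup (map_f mu)// mem_filter mu0 mem_iota add0n ltn_ord.
apply: (@le_trans _ _ (\sum_(j < K) (if lambda j \in s then f (lambda j) else 0)));
    last first.
  by apply: ler_sum => j _; case: ifP.
rewrite (split_levels _ (fun j : 'I_N => mu j)).
rewrite (split_levels _ (fun j : 'I_K => lambda j)).
rewrite big_seq [leRHS]big_seq; apply: ler_sum => m ms.
have [Nm mem_level] := levelP _ ms.
have fm0 : 0 <= f m.
  apply: f_ge0; move: ms; rewrite mem_undup => /mapP[j _ ->].
  by case: (emu j) => [[->]|[/ltW]].
apply: ler_wpMn2l => //; apply: (leq_trans Nm).
have sub : {subset level m <= [seq val j | j in [pred j : 'I_K | lambda j == m]]}.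
  move=> j jm; have jK := levelK _ _ ms jm.
  by apply/fintype.imageP; exists (Ordinal jK) => //; rewrite inE -mem_level.
by apply: leq_trans (uniq_leq_size (finmap.fset_uniq _) sub) _; rewrite size_image.
Qed.

End multiplicity.

(** * Random signs *)

Section laws.
Context d (Omega : measurableType d) (R : realType) (P : probability Omega R).

(** Open rays generate the measurable sets of [R], and their preimages are open. *)
Lemma borel_preimage (T : topologicalType) (f : T -> R) (B : set R) :
  continuous f -> measurable B -> borel (f @^-1` B).
Proof.
move=> cf mB.
have {}mB : (@RGenOInfty.G R).-sigma.-measurable B by rewrite -(RGenOInfty.measurableE R).
have [s0 sD sU] := @smallest_sigma_algebra T setT (@open T).
apply: (mB [set B | borel (f @^-1` B)]); split; first split=> /=.
- by rewrite preimage_set0.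
- by move=> A bA; exact: (sD _ bA).
- by move=> A bA; rewrite preimage_bigcup; exact: sU.
- move=> _ [a ->]; apply: sub_gen_smallest.
  by apply: open_comp => [x _|]; [exact: cf|exact: interval_open].
Qed.

Lemma random_element_comp (T : topologicalType) (x : Omega -> T) (f : T -> R) :
  random_element P x -> continuous f -> measurable_fun setT (f \o x).
Proof.
move=> [mx _] cf _ B mB; rewrite setTI comp_preimage.
by apply: mx; exact: borel_preimage.
Qed.

Lemma identically_distributed_integral (T : topologicalType) (x y : Omega -> T)
    (f : T -> R) : random_element P x -> random_element P y ->
  identically_distributed P x y -> continuous f -> (forall t, 0 <= f t) ->
  (\int[P]_omega (f (x omega))%:E = \int[P]_omega (f (y omega))%:E)%E.
Proof.
move=> rx ry xy cf f0.
have mfx := random_element_comp rx cf; have mfy := random_element_comp ry cf.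
pose X : {RV P >-> R} := HB.pack (f \o x) (isMeasurableFun.Build _ _ _ _ _ mfx).
pose Y : {RV P >-> R} := HB.pack (f \o y) (isMeasurableFun.Build _ _ _ _ _ mfy).
(* Truncation at 0 is nonnegative on all of [R] and agrees with the identity on the values of
   [f]. *)
pose h (t : R) : \bar R := (Num.max t 0)%:E.
have mh : measurable_fun setT h.
  by apply/measurable_EFinP; apply: measurable_maxr.
have h0 t : (0 <= h t)%E by rewrite lee_fin le_max lexx orbT.
have hE z : h (f z) = (f z)%:E by rewrite /h max_l.
transitivity (\int[P]_omega ((h \o X) omega))%E.
  by apply: eq_integral => w _; rewrite -hE.
transitivity (\int[P]_omega ((h \o Y) omega))%E; last first.
  by apply: eq_integral => w _; rewrite -hE.
rewrite -!ge0_integral_distribution//; apply: eq_measure_integral => B mB _.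
exact: (xy _ (borel_preimage cf mB)).
Qed.

End laws.

(** * Symmetry of products with random signs *)

Section signed_products.
Context d (Omega : measurableType d) (R : realType) (P : probability Omega R).

Let p (E : set Omega) : R := fine (P E).

Let pE (E : set Omega) : measurable E -> P E = (p E)%:E.
Proof. by move=> mE; rewrite /p fineK// fin_num_measure. Qed.

(** The values 1 and -1 carry total mass 1, so the rest of [E] is null. *)
Lemma rademacher_split (s : {RV P >-> R}) E : rademacher P s -> measurable E ->
  p E = p (s @^-1` [set 1] `&` E) + p (s @^-1` [set - 1] `&` E).
Proof.
move=> [s1 sN1] mE; set A := s @^-1` [set 1]; set B := s @^-1` [set - 1].
have mA : measurable A by exact: measurable_funPTI.
have mB : measurable B by exact: measurable_funPTI.
have AB0 : A `&` B = set0.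
  apply/seteqP; split => // w [sw1 swN1].
  by have : (1 : R) = -1 := etrans (esym sw1) swN1; lra.
have AB1 : P (A `|` B) = 1%E.
  have PA : P A = 2^-1%:E by exact: s1.
  have PB : P B = 2^-1%:E by exact: sN1.
  transitivity (P A + P B)%E; first exact: measureU.
  rewrite PA PB -EFinD; congr (_%:E); lra.
have PC : P (~` (A `|` B)) = 0%E.
  by rewrite probability_setC ?AB1 ?subee//; exact: measurableU.
have N0 : P (E `\` (A `|` B)) = 0%E.
  apply: (@subset_measure0 _ _ _ P _ (~` (A `|` B))) => //.
  - by apply: measurableD => //; exact: measurableU.
  - by apply: measurableC; exact: measurableU.
apply: EFin_inj; rewrite EFinD -!pE//; [|exact: measurableI..].
transitivity (P (E `\` (A `|` B)) + P (E `&` (A `|` B)))%E.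
  by apply: measureDI => //; exact: measurableU.
rewrite N0 add0e setIC setIUl; apply: measureU; [exact: measurableI..|].
by rewrite setIACA AB0 set0I.
Qed.

(** [U = s X] is symmetric and independent of [V = t Y], so [(U, V)] and [(- U, V)] have the same
    law; the integral of [U V] thus equals its opposite. *)
Lemma signed_product_integral0 (s t X Y : {RV P >-> R}) :
  rademacher P s -> rademacher P t ->
  (forall a b B C, measurable B -> measurable C ->
    P (s @^-1` [set a] `&` (X @^-1` B `&` (t @^-1` [set b] `&` Y @^-1` C))) =
    (P (s @^-1` [set a] `&` X @^-1` B) * P (t @^-1` [set b] `&` Y @^-1` C))%E) ->
  (forall a B, measurable B ->
    P (s @^-1` [set a] `&` X @^-1` B) = (P (s @^-1` [set a]) * P (X @^-1` B))%E) ->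
  P.-integrable setT (fun omega => (s omega * X omega * (t omega * Y omega))%:E) ->
  (\int[P]_omega (s omega * X omega * (t omega * Y omega))%:E = 0)%E.
Proof.
move=> rs rt indep indepX intUV.
have [[s1 sN1] [t1 tN1]] := (rs, rt).
pose U : {RV P >-> R} := (s \* X : Omega -> R).
pose V : {RV P >-> R} := (t \* Y : Omega -> R).
have mN : measurable_fun setT (-%R : R -> R) by exact: oppr_measurable.
have moppr (B : set R) : measurable B -> measurable (-%R @^-1` B).
  by move=> mB; rewrite -(setTI (_ @^-1` _)); exact: (mN measurableT _ mB).
have Uhalf (B : set R) : measurable B ->
    p (U @^-1` B) = 2^-1 * p (X @^-1` B) + 2^-1 * p (X @^-1` (-%R @^-1` B)).
  move=> mB; rewrite (rademacher_split rs); last exact: measurable_funPTI.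
  have mNB := moppr _ mB.
  have -> : s @^-1` [set 1] `&` U @^-1` B = s @^-1` [set 1] `&` X @^-1` B.
    by apply/seteqP; split => w [/= sw]; rewrite sw mul1r.
  have -> : s @^-1` [set -1] `&` U @^-1` B = s @^-1` [set -1] `&` X @^-1` (-%R @^-1` B).
    by apply/seteqP; split => w [/= sw]; rewrite sw mulN1r.
  by rewrite /p !indepX// s1 sN1 !fineM// fin_num_measure//; exact: measurable_funPTI.
have Usym (B : set R) : measurable B -> p (U @^-1` (-%R @^-1` B)) = p (U @^-1` B).
  move=> mB; have mNB := moppr _ mB.
  rewrite !Uhalf// addrC; congr (_ * p _ + _).
  by apply/seteqP; split => w /=; rewrite opprK.
have splitU (E : set R) (a : R) : s @^-1` [set a] `&` (U @^-1` E) =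
    s @^-1` [set a] `&` X @^-1` (fun r => E (a * r)).
  by apply/seteqP; split => w [/= sw]; rewrite sw.
have splitV (E : set R) (a : R) : t @^-1` [set a] `&` (V @^-1` E) =
    t @^-1` [set a] `&` Y @^-1` (fun r => E (a * r)).
  by apply/seteqP; split => w [/= sw]; rewrite sw.
have mscale (E : set R) (a : R) : measurable E -> measurable (fun r : R => E (a * r)).
  move=> mE; have : measurable_fun setT (fun r : R => a * r) by exact: mulrl_measurable.
  by move=> /(_ measurableT _ mE); rewrite setTI.
(* The independence at hand concerns signs and factors; splitting over the four sign patterns turns
   events on [U] and [V] into such events. *)
have UV (B C : set R) : measurable B -> measurable C ->
    p (U @^-1` B `&` V @^-1` C) = p (U @^-1` B) * p (V @^-1` C).
  move=> mB mC; have mUB : measurable (U @^-1` B) by exact: measurable_funPTI.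
  have mVC : measurable (V @^-1` C) by exact: measurable_funPTI.
  have pIM (a b : R) :
      p (s @^-1` [set a] `&` (t @^-1` [set b] `&` (U @^-1` B `&` V @^-1` C))) =
      p (s @^-1` [set a] `&` U @^-1` B) * p (t @^-1` [set b] `&` V @^-1` C).
    have mE1 : measurable (s @^-1` [set a] `&` U @^-1` B).
      by apply: measurableI => //; exact: measurable_funPTI.
    have mE2 : measurable (t @^-1` [set b] `&` V @^-1` C).
      by apply: measurableI => //; exact: measurable_funPTI.
    have -> : s @^-1` [set a] `&` (t @^-1` [set b] `&` (U @^-1` B `&` V @^-1` C)) =
        (s @^-1` [set a] `&` U @^-1` B) `&` (t @^-1` [set b] `&` V @^-1` C).
      by apply/seteqP; split => w; rewrite /setI/=; tauto.
    apply: EFin_inj; rewrite EFinM -!pE//; last exact: measurableI.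
    rewrite (splitU B a) (splitV C b) -indep; [|exact: mscale..].
    by rewrite !setIA.
  rewrite (rademacher_split rs); last exact: measurableI.
  have mst (a : R) : measurable (s @^-1` [set a] `&` (U @^-1` B `&` V @^-1` C)).
    by apply: measurableI; [exact: measurable_funPTI|exact: measurableI].
  rewrite (rademacher_split rt (mst 1)) (rademacher_split rt (mst (-1))).
  rewrite (rademacher_split rs mUB) (rademacher_split rt mVC).
  by rewrite ![_ `&` (s @^-1` _ `&` _)]setICA !pIM; ring.
pose UVp : {RV P >-> (R * R)%type} := HB.pack (fun w => (U w, V w))
  (isMeasurableFun.Build _ _ _ _ _
    (measurable_fun_pair (measurable_funP U) (measurable_funP V))).
pose UVn : {RV P >-> (R * R)%type} := HB.pack (fun w => (- U w, V w))
  (isMeasurableFun.Build _ _ _ _ _ (measurable_fun_pair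
    (measurableT_comp mN (measurable_funP U)) (measurable_funP V))).
pose h (z : R * R) : \bar R := (z.1 * z.2)%:E.
have mh : measurable_fun setT h.
  by apply/measurable_EFinP; apply: measurable_funM.
have lawp W : measurable W ->
    (distribution P U \x distribution P V)%E W = distribution P UVp W.
  apply: product_measure_unique => B C mB mC.
  change (P (U @^-1` B `&` V @^-1` C) = P (U @^-1` B) * P (V @^-1` C))%E.
  rewrite !pE; last 3 first.
  - exact: measurable_funPTI.
  - exact: measurable_funPTI.
  - by apply: measurableI; exact: measurable_funPTI.
  by rewrite UV.
have lawn W : measurable W ->
    (distribution P U \x distribution P V)%E W = distribution P UVn W.
  apply: product_measure_unique => B C mB mC.
  have mNB := moppr _ mB.
  change (P (U @^-1` (-%R @^-1` B) `&` V @^-1` C) = P (U @^-1` B) * P (V @^-1` C))%E.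
  rewrite !pE; last 3 first.
  - exact: measurable_funPTI.
  - exact: measurable_funPTI.
  - by apply: measurableI; exact: measurable_funPTI.
  by rewrite UV// Usym.
have intp : P.-integrable setT (h \o UVp) by exact: intUV.
have hn : h \o UVn = (fun w => - (h \o UVp) w)%E.
  by apply/funext => w; rewrite /h/= mulNr EFinN.
have intn : P.-integrable setT (h \o UVn) by rewrite hn; exact: integrableN.
have : (\int[P]_w (h \o UVp) w = \int[P]_w (h \o UVn) w)%E.
  rewrite -!integral_distribution//; apply: eq_measure_integral => W mW _.
  exact: etrans (esym (lawp _ mW)) (lawn _ mW).
rewrite hn integralN; last exact: integrable_add_def.
(* Finiteness is what lets [I = - I] give 0. *)
have := integrable_fin_num measurableT intp.
move: (\int[P]_w (h \o UVp) w)%E => [I| |]// _ [II].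
by congr (_%:E); lra.
Qed.
End signed_products.

(** * Second moments of signed sums *)

Section sample_signs.
Context d (Omega : measurableType d) (R : realType) (P : probability Omega R).

(** The exceptional event is split by the value of the sign, and both pieces are empty. *)
Lemma rademacher_ae (s : {RV P >-> R}) : rademacher P s ->
  {ae P, forall omega, s omega ^+ 2 = 1}.
Proof.
move=> rs; pose E := ~` (s @^-1` [set 1] `|` s @^-1` [set - 1]).
have mE : measurable E.
  by apply: measurableC; apply: measurableU; exact: measurable_funPTI.
exists E; split => //.
  have := rademacher_split rs mE.
  have -> : s @^-1` [set 1] `&` E = set0 by apply/seteqP; split => // w [? []]; left.
  have -> : s @^-1` [set -1] `&` E = set0 by apply/seteqP; split => // w [? []]; right.
  rewrite measure0/= addr0 => E0; rewrite -[P E]fineK ?fin_num_measure//.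
  by congr (_%:E).
move=> w /= sw [] /= s1; apply: sw; rewrite s1 ?expr1n//.
by rewrite sqrrN expr1n.
Qed.

Lemma mutually_independent_seq (I : finType) (F : I -> set (set Omega))
    (l : seq I) (A : I -> set Omega) : mutually_independent P F -> uniq l ->
  (forall k, F k (A k)) ->
  P (\big[setI/setT]_(k <- l) A k) = (\prod_(k <- l) P (A k))%E.
Proof.
move=> indep ul FA; rewrite -bigcap_seq big_uniq//=.
have -> : [set` l] = [set` [set k in l]%SET].
  by apply/seteqP; split => k /=; rewrite inE.
rewrite indep//; apply: eq_bigl => k; by rewrite inE.
Qed.

Context (T : topologicalType) (n : nat) (xs : 'I_n -> Omega -> T).
Context (sigma : 'I_n -> {RV P >-> R}).
Hypothesis xs_random : forall i, random_element P (xs i).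
Hypothesis sigma_law : forall i, rademacher P (sigma i).
Hypothesis indep : independent_sample_signs P xs (fun i => sigma i).
Context (f : T -> R).
Hypothesis cf : continuous f.
Hypothesis f2 : forall i, P.-integrable setT (fun omega => (f (xs i omega) ^+ 2)%:E).

Let mfx i : measurable_fun setT (f \o xs i).
Proof. exact: (random_element_comp (xs_random i) cf). Qed.

Let U i omega : R := sigma i omega * f (xs i omega).

Let mU i : measurable_fun setT (U i).
Proof. by apply: measurable_funM; [exact: measurable_funP|exact: mfx]. Qed.

Lemma integral_sign_sqr i :
  (\int[P]_omega (U i omega ^+ 2)%:E = \int[P]_omega (f (xs i omega) ^+ 2)%:E)%E.
Proof.
apply: ge0_ae_eq_integral => //.
- by apply/measurable_EFinP; apply: measurable_funX; exact: mU.
- exact: (measurable_int P (f2 i)).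
- by move=> w _; rewrite lee_fin sqr_ge0.
- by move=> w _; rewrite lee_fin sqr_ge0.
- apply: filterS (rademacher_ae (sigma_law i)) => w sw _.
  by rewrite /U exprMn sw mul1r.
Qed.

Let intU2 i : P.-integrable setT (fun omega => (U i omega ^+ 2)%:E).
Proof.
apply/integrableP; split.
  by apply/measurable_EFinP; apply: measurable_funX; exact: mU.
under eq_integral do rewrite gee0_abs ?lee_fin ?sqr_ge0//.
rewrite integral_sign_sqr.
have /integrableP[_] := f2 i.
by under eq_integral do rewrite gee0_abs ?lee_fin ?sqr_ge0//.
Qed.

Let intUU i j : P.-integrable setT (fun omega => (U i omega * U j omega)%:E).
Proof.
apply: (le_integrable measurableT _ _ (integrableD measurableT (intU2 i) (intU2 j))).
  by apply/measurable_EFinP; apply: measurable_funM; exact: mU.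
move=> w _ /=; rewrite lee_fin [leRHS]ger0_norm ?addr_ge0 ?sqr_ge0// normrM.
rewrite -(real_normK (num_real (U i w))) -(real_normK (num_real (U j w))).
have := sqr_ge0 (`|U i w| - `|U j w|); have := normr_ge0 (U i w).
have := normr_ge0 (U j w); nra.
Qed.

Let cross i j : i != j -> (\int[P]_omega (U i omega * U j omega)%:E = 0)%E.
Proof.
move=> ij.
pose X : {RV P >-> R} := HB.pack (f \o xs i) (isMeasurableFun.Build _ _ _ _ _ (@mfx i)).
pose Y : {RV P >-> R} := HB.pack (f \o xs j) (isMeasurableFun.Build _ _ _ _ _ (@mfx j)).
(* One family supplies all events required: only the indices [i] and [j] are selected below, so the
   [else] branches serve [j]. *)
pose A a b (B C : set R) (k : 'I_n + 'I_n) : set Omega :=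
  match k with
  | inl l => if l == i then xs l @^-1` (f @^-1` B) else xs l @^-1` (f @^-1` C)
  | inr l => if l == i then sigma l @^-1` [set a] else sigma l @^-1` [set b]
  end.
have ji : (j == i) = false by rewrite eq_sym (negbTE ij).
have PA a b B C l : measurable B -> measurable C -> uniq l ->
    P (\big[setI/setT]_(k <- l) A a b B C k) = (\prod_(k <- l) P (A a b B C k))%E.
  move=> mB mC ul; apply: (mutually_independent_seq indep ul) => -[] k /=.
    have [->|_] := eqVneq k i.
      by exists (f @^-1` B); [exact: borel_preimage|rewrite setTI].
    by exists (f @^-1` C); [exact: borel_preimage|rewrite setTI].
  have [->|_] := eqVneq k i.
    by exists [set a]; [exact: measurable_set1|rewrite setTI].
  by exists [set b]; [exact: measurable_set1|rewrite setTI].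
have uniq2 k : uniq [:: inr k; inl k : 'I_n + 'I_n] by [].
have uniq4 : uniq [:: inr i; inl i; inr j; inl j : 'I_n + 'I_n].
  have rr : (inr i == inr j :> 'I_n + 'I_n) = false by exact: negbTE ij.
  have ll : (inl i == inl j :> 'I_n + 'I_n) = false by exact: negbTE ij.
  by rewrite /= !inE rr ll.
apply: (@signed_product_integral0 _ _ _ P (sigma i) (sigma j) X Y) => //.
- move=> a b B C mB mC.
  have := PA a b B C _ mB mC uniq4; have := PA a b B C _ mB mC (uniq2 i).
  have := PA a b B C _ mB mC (uniq2 j).
  rewrite !big_cons !big_nil /A eqxx ji !setIT !mule1.
  by move=> -> -> ->; rewrite !muleA.
- move=> a B mB; have := PA a a B B _ mB mB (uniq2 i).
  by rewrite !big_cons !big_nil /A eqxx setIT mule1.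
- exact: intUU.
Qed.

Lemma integral_sign_sum_sqr :
  (\int[P]_omega ((\sum_i sigma i omega * f (xs i omega)) ^+ 2)%:E =
   \sum_i \int[P]_omega (f (xs i omega) ^+ 2)%:E)%E.
Proof.
transitivity (\int[P]_omega (\sum_i \sum_j (U i omega * U j omega)%:E))%E.
  apply: eq_integral => w _; rewrite expr2 mulr_suml -sumEFin; apply: eq_bigr => i _.
  by rewrite mulr_sumr -sumEFin.
rewrite integral_sum//; last by move=> i; apply: integrable_sum.
apply: eq_bigr => i _; rewrite integral_sum//.
rewrite (bigD1 i)//= big1 ?adde0; last by move=> j ji; rewrite cross// eq_sym.
exact: integral_sign_sqr.
Qed.

End sample_signs.

(** * Local Rademacher complexity *)

Section weighted_bound.
Context (R : realType).

(** Times [4 c k], the difference of the two sides is [(c k a - 2 s)^2 + 4 (k b - 1) s^2]. *)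
Lemma weighted_am_gm (a s k b c : R) : 0 < c -> 0 < k -> 1 <= k * b ->
  a * s <= c / 4 * (k * a ^+ 2) + c^-1 * (b * s ^+ 2).
Proof.
move=> c0 k0 kb.
have h : 0 <= (c * k * a - 2 * s) ^+ 2 + 4 * (k * b - 1) * s ^+ 2.
  by rewrite addr_ge0 ?sqr_ge0// mulr_ge0 ?sqr_ge0//; lra.
rewrite -subr_ge0 -(pmulr_rge0 _ (_ : 0 < 4 * c * k)); last by rewrite !mulr_gt0.
apply: le_trans h _; rewrite le_eqVlt; apply/orP; left; apply/eqP.
by field; rewrite gt_eqF.
Qed.

Context (V : hilbertType R) (e : nat -> V) (mu : nat -> R).
Hypothesis e_orth : forall i j, i != j -> inner (e i) (e j) = 0.
Hypothesis emu : forall j, (mu j = 0 /\ e j = 0) \/ (0 < mu j /\ `|e j| = 1).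
Implicit Types (w S : V).

(** Convexity of the squared norm, from [2 <v_i, v_j> <= |v_i|^2 + |v_j|^2]. *)
Lemma normr_mean_sqr n (v : 'I_n -> V) : (0 < n)%N ->
  `|n%:R^-1 *: \sum_i v i| ^+ 2 <= n%:R^-1 * \sum_i `|v i| ^+ 2.
Proof.
move=> n0; have N0 : 0 < n%:R :> R by rewrite ltr0n.
rewrite -inner_normE innerZl innerZr ler_pM2l ?invr_gt0// ler_pdivrMl//.
rewrite inner_suml; under eq_bigr do rewrite inner_sumr.
apply: (@le_trans _ _ (\sum_i \sum_j (2^-1 * `|v i| ^+ 2 + 2^-1 * `|v j| ^+ 2))).
  apply: ler_sum => i _; apply: ler_sum => j _.
  by have := sqr_ge0 `|v i - v j|; rewrite normB_sqr; lra.
under eq_bigr do rewrite big_split/=.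
rewrite big_split/=; set T := \sum_i `|v i| ^+ 2.
have -> : \sum_i \sum_(j < n) 2^-1 * `|v i| ^+ 2 = n%:R * (2^-1 * T).
  rewrite /T !mulr_sumr; apply: eq_bigr => i _.
  by rewrite sumr_const card_ord mulr_natl.
have -> : \sum_(i < n) \sum_j 2^-1 * `|v j| ^+ 2 = n%:R * (2^-1 * T).
  by rewrite sumr_const card_ord mulr_natl -mulr_sumr.
lra.
Qed.

(* [cutoff r C j = 0] when [mu j = 0], since [r / 0 = 0]; then [e j = 0] too. *)
Definition cutoff (r C : R) j := Num.min (r / mu j) C.

Lemma cutoff_ge0 r C j : 0 < r -> 0 < C -> 0 <= cutoff r C j.
Proof.
move=> r0 C0; rewrite le_min (ltW C0) andbT divr_ge0 ?(ltW r0)//.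
by case: (emu j) => [[->]|[/ltW]].
Qed.

Lemma cutoff_eigenvalue r C j : 0 < r -> 0 < C ->
  cutoff r C j * mu j = Num.min r (C * mu j).
Proof.
move=> r0 C0; case: (emu j) => [[-> _]|[mu0 _]].
  by rewrite !mulr0 min_r// ltW.
by rewrite /cutoff minr_pMl ?(ltW mu0)// divfK// gt_eqF.
Qed.

Lemma inner_le_weighted N (r C c : R) w S : 0 < r -> 0 < C -> 0 < c ->
  `|w| ^+ 2 <= C -> \sum_(j < N) mu j * inner w (e j) ^+ 2 <= r ->
  inner w S <= c / 2 + c^-1 *
    (\sum_(j < N) cutoff r C j * inner S (e j) ^+ 2 + C * `|remainder e N S| ^+ 2).
Proof.
move=> r0 C0 c0 wC wr.
have e01 j : e j = 0 \/ `|e j| = 1 by case: (emu j) => -[]; [left|right].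
have wS : inner w S = \sum_(j < N) inner w (e j) * inner S (e j) +
    inner (remainder e N w) (remainder e N S).
  rewrite inner_remainder// [in X in _ + X]/remainder innerBr inner_sumr.
  rewrite [X in X + _](_ : _ = \sum_(j < N) inner w (inner S (e j) *: e j)).
    by rewrite addrC subrK.
  by apply: eq_bigr => j _; rewrite innerZr mulrC.
have hj (j : 'I_N) : inner w (e j) * inner S (e j) <=
    c / 4 * ((mu j / r + C^-1) * inner w (e j) ^+ 2) +
    c^-1 * (cutoff r C j * inner S (e j) ^+ 2).
  case: (emu j) => [[_ ->]|[mu0 _]].
    by rewrite !inner0r !expr0n/= !mulr0 addr0.
  apply: weighted_am_gm => //; first by rewrite addr_gt0 ?divr_gt0 ?invr_gt0.
  (* Whichever term attains the minimum, its product with the matching weight is already 1. *)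
  rewrite /cutoff; case: (leP (r / mu j) C) => _.
    have -> : (mu j / r + C^-1) * (r / mu j) = 1 + r / (mu j * C).
      by field; rewrite !gt_eqF.
    by rewrite lerDl divr_ge0 ?mulr_ge0// ltW.
  have -> : (mu j / r + C^-1) * C = 1 + mu j * C / r by field; rewrite !gt_eqF.
  by rewrite lerDl divr_ge0 ?mulr_ge0// ltW.
have hr : inner (remainder e N w) (remainder e N S) <=
    c / 4 * (C^-1 * `|remainder e N w| ^+ 2) + c^-1 * (C * `|remainder e N S| ^+ 2).
  apply: le_trans (ler_norm _) _; apply: le_trans (normr_inner_le _ _) _.
  by apply: weighted_am_gm; rewrite ?invr_gt0// mulVf// gt_eqF.
rewrite wS; apply: le_trans (lerD (ler_sum _ (fun j _ => hj j)) hr) _.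
rewrite big_split/= -!mulr_sumr normr_remainder//.
set A := \sum_(j < N) mu j * _ in wr; set B := \sum_(j < N) inner w _ ^+ 2.
have -> : \sum_(j < N) (mu j / r + C^-1) * inner w (e j) ^+ 2 = A / r + C^-1 * B.
  rewrite mulr_suml mulr_sumr -big_split/=; apply: eq_bigr => j _.
  by rewrite mulrDl mulrAC.
set Z1 := \sum_(j < N) cutoff _ _ _ * _; set Z2 := C * _.
(* [B] cancels; the constraints on [A] and on [|w|^2] then contribute 1 each. *)
have : A / r + C^-1 * B + C^-1 * (`|w| ^+ 2 - B) <= 2.
  have h1 : A / r <= 1 by rewrite ler_pdivrMr// mul1r.
  have h2 : C^-1 * `|w| ^+ 2 <= 1 by rewrite mulrC ler_pdivrMr// mul1r.
  by rewrite mulrBr; lra.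
move=> h; have := ler_wpM2l (_ : 0 <= c / 4) h; rewrite divr_ge0 ?(ltW c0)// => /(_ isT).
by rewrite mulrDr; lra.
Qed.

End weighted_bound.

(** * From the pointwise bound to the expectation *)

Section local_rademacher_bound.
Context d (Omega : measurableType d) (R : realType) (P : probability Omega R).

(* No measurability of [f] is needed: the integral of a nonnegative function
   is a supremum over the simple functions below it. *)
Lemma le_nonmeasurable_integral (f g : Omega -> \bar R) :
  (forall omega, (0 <= f omega)%E) -> (forall omega, (f omega <= g omega)%E) ->
  (\int[P]_omega f omega <= \int[P]_omega g omega)%E.
Proof.
move=> f0 fg; rewrite !ge0_integralTE//; last first.
  by move=> w; exact: le_trans (f0 w) (fg w).
apply: ereal_sup_le => _ [h hf <-]; exists h => // w.
exact: le_trans (hf w) (fg w).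
Qed.

Lemma sume_const_ord n (c : \bar R) : (\sum_(i < n) c = n%:R%:E * c)%E.
Proof.
elim: n => [|n IH]; first by rewrite big_ord0 mul0e.
by rewrite big_ord_recr/= IH -natr1 EFinD ge0_muleDl ?mul1e// lee_fin.
Qed.

Context (V : hilbertType R) (x : Omega -> V) (n : nat).
Context (xs : 'I_n -> Omega -> V) (sigma : 'I_n -> {RV P >-> R}).
Hypothesis n_gt0 : (0 < n)%N.
Hypothesis x_random : random_element P x.
Hypothesis x_L2 : ('E_P[fun omega => (`|x omega| ^+ 2)%R] < +oo)%E.
Hypothesis xs_random : forall i, random_element P (xs i).
Hypothesis xs_law : forall i, identically_distributed P (xs i) x.
Hypothesis sigma_law : forall i, rademacher P (sigma i).
Hypothesis indep : independent_sample_signs P xs (fun i => sigma i).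

Let N0 : 0 < n%:R :> R. Proof. by rewrite ltr0n. Qed.

Let xm (f : V -> R) : continuous f -> measurable_fun setT (f \o x).
Proof. by move=> cf; exact: (random_element_comp x_random cf). Qed.

Let csqr_norm : continuous (fun v : V => `|v| ^+ 2).
Proof. by apply: continuous_sqrf => v; exact: norm_continuous. Qed.

Let csqr_inner (v : V) : continuous (fun u : V => inner u v ^+ 2 : R).
Proof. by apply: continuous_sqrf; exact: inner_continuous. Qed.

Lemma integrable_normr_sqr : P.-integrable setT (fun omega => (`|x omega| ^+ 2)%:E).
Proof.
apply/integrableP; split; first by apply/measurable_EFinP; exact: (xm csqr_norm).
under eq_integral do rewrite gee0_abs ?lee_fin ?sqr_ge0//.
by move: x_L2; rewrite unlock.
Qed.

Let x2 := integrable_normr_sqr.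

Lemma integrable_sample_normr_sqr i :
  P.-integrable setT (fun omega => (`|xs i omega| ^+ 2)%:E).
Proof.
apply/integrableP; split.
  by apply/measurable_EFinP; exact: (random_element_comp (xs_random i) csqr_norm).
under eq_integral do rewrite gee0_abs ?lee_fin ?sqr_ge0//.
rewrite (identically_distributed_integral (xs_random i) x_random (xs_law i) csqr_norm).
  by move: x_L2; rewrite unlock.
by move=> v; exact: sqr_ge0.
Qed.

Let S omega : V := n%:R^-1 *: \sum_(i < n) sigma i omega *: xs i omega.

(** The signs make the [n] summands orthogonal in mean square, which leaves a factor [n / n^2]. *)
Lemma integral_inner_sample_sqr v : (\int[P]_omega (inner (S omega) v ^+ 2)%:E =
  (n%:R^-1)%:E * \int[P]_omega (inner v (x omega) ^+ 2)%:E)%E.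
Proof.
have f2 i : P.-integrable setT (fun omega => (inner (xs i omega) v ^+ 2 : R)%:E).
  have int_v := integrableZl measurableT (`|v| ^+ 2) (integrable_sample_normr_sqr i).
  apply: (le_integrable measurableT _ _ int_v).
    apply/measurable_EFinP.
    exact: (random_element_comp (xs_random i) (csqr_inner (v:=v))).
  move=> w _; rewrite -EFinM lee_fin !ger0_norm ?sqr_ge0//.
  by rewrite mulrC cauchy_schwarz.
transitivity (\int[P]_omega ((n%:R^-1 ^+ 2)%:E *
    ((\sum_i sigma i omega * inner (xs i omega) v) ^+ 2)%:E))%E.
  apply: eq_integral => w _; rewrite -EFinM -exprMn /S innerZl inner_suml.
  by under eq_bigr do rewrite innerZl.
rewrite ge0_integralZl_EFin//; last 2 first.
- by move=> w _; rewrite lee_fin sqr_ge0.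
- apply/measurable_EFinP; apply: measurable_funX; apply: measurable_sum => i.
  apply: measurable_funM; first exact: measurable_funP.
  exact: (random_element_comp (xs_random i) (@inner_continuous _ _ v)).
rewrite (integral_sign_sum_sqr xs_random sigma_law indep (@inner_continuous _ _ v) f2).
have xiE i : (\int[P]_omega (inner (xs i omega) v ^+ 2)%:E =
    \int[P]_omega (inner v (x omega) ^+ 2)%:E)%E.
  rewrite (identically_distributed_integral (xs_random i) x_random (xs_law i)
    (csqr_inner (v:=v))).
    by apply: eq_integral => w _; rewrite innerC.
  by move=> u; exact: sqr_ge0.
under eq_bigr do rewrite xiE.
rewrite sume_const_ord muleA -EFinM; congr (_%:E * _)%E.
by rewrite expr2 -mulrA mulVf ?mulr1// gt_eqF.
Qed.

Let measurable_signed_remainder e N i :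
  (forall i j, i != j -> inner (e i) (e j) = 0 :> R) ->
  (forall j, e j = 0 :> V \/ `|e j| = 1) ->
  measurable_fun setT (fun omega => `|sigma i omega *: remainder e N (xs i omega)| ^+ 2).
Proof.
move=> e_orth e01; have cr := remainder_continuous e_orth e01 (N := N).
have crn : continuous (fun v => `|remainder e N v| ^+ 2 : R).
  apply: continuous_sqrf => v; apply: continuous_comp; first exact: cr.
  exact: norm_continuous.
have -> : (fun omega => `|sigma i omega *: remainder e N (xs i omega)| ^+ 2) =
    (fun omega => sigma i omega ^+ 2 * `|remainder e N (xs i omega)| ^+ 2).
  by apply/funext => w; rewrite normrZ exprMn real_normK ?num_real.
apply: measurable_funM; last exact: (random_element_comp (xs_random i) crn).
by apply: measurable_funX; exact: measurable_funP.
Qed.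

(** A sign almost surely preserves norms, so all [n] averaged terms have the expectation of the
    remainder of [x]. *)
Lemma integral_remainder_sample e N :
  (forall i j, i != j -> inner (e i) (e j) = 0 :> R) ->
  (forall j, e j = 0 :> V \/ `|e j| = 1) ->
  (\int[P]_omega
     (n%:R^-1 * \sum_i `|sigma i omega *: remainder e N (xs i omega)| ^+ 2)%:E =
   \int[P]_omega (`|remainder e N (x omega)| ^+ 2)%:E)%E.
Proof.
move=> e_orth e01; have cr := remainder_continuous e_orth e01 (N := N).
have crn : continuous (fun v => `|remainder e N v| ^+ 2 : R).
  apply: continuous_sqrf => v; apply: continuous_comp; first exact: cr.
  exact: norm_continuous.
have mr i : measurable_fun setT (fun omega => `|remainder e N (xs i omega)| ^+ 2).
  exact: (random_element_comp (xs_random i) crn).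
have nE i omega : `|sigma i omega *: remainder e N (xs i omega)| ^+ 2 =
    sigma i omega ^+ 2 * `|remainder e N (xs i omega)| ^+ 2.
  by rewrite normrZ exprMn real_normK ?num_real.
have ms i : measurable_fun setT
    (fun omega => (`|sigma i omega *: remainder e N (xs i omega)| ^+ 2)%:E).
  by apply/measurable_EFinP; exact: measurable_signed_remainder.
under eq_integral do rewrite EFinM -sumEFin.
rewrite ge0_integralZl_EFin//; last 2 first.
- by move=> w _; apply: sume_ge0 => i _; rewrite lee_fin sqr_ge0.
- by apply: emeasurable_sum => i; exact: ms.
rewrite ge0_integral_sum//.
have xiE i : (\int[P]_omega (`|sigma i omega *: remainder e N (xs i omega)| ^+ 2)%:E =
    \int[P]_omega (`|remainder e N (x omega)| ^+ 2)%:E)%E.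
  rewrite -(identically_distributed_integral (xs_random i) x_random (xs_law i) crn);
    last first.
    by move=> u; exact: sqr_ge0.
  apply: ge0_ae_eq_integral => //.
  - by apply/measurable_EFinP; exact: mr.
  - by apply: filterS (rademacher_ae (sigma_law i)) => w sw _; rewrite nE sw mul1r.
under eq_bigr do rewrite xiE.
rewrite sume_const_ord muleA -EFinM.
by rewrite mulVf ?mul1e// gt_eqF.
Qed.

Let measurable_inner_sample v : measurable_fun setT (fun omega => inner (S omega) v : R).
Proof.
have -> : (fun omega => inner (S omega) v : R) =
    (fun omega => n%:R^-1 * \sum_i sigma i omega * inner (xs i omega) v).
  apply/funext => w; rewrite /S innerZl inner_suml.
  by under eq_bigr do rewrite innerZl.
apply: measurable_funM; first exact: measurable_cst.
apply: measurable_sum => i; apply: measurable_funM; first exact: measurable_funP.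
exact: (random_element_comp (xs_random i) (@inner_continuous _ _ v)).
Qed.

(** The remainder is linear, being self-adjoint, and the squared norm is convex. The bound treats
    each sample separately, so its measurability reduces to that of single samples. *)
Lemma normr_remainder_sample e N omega :
  (forall i j, i != j -> inner (e i) (e j) = 0 :> R) ->
  (forall j, e j = 0 :> V \/ `|e j| = 1) ->
  `|remainder e N (S omega)| ^+ 2 <=
  n%:R^-1 * \sum_i `|sigma i omega *: remainder e N (xs i omega)| ^+ 2.
Proof.
move=> e_orth e01; have rs := remainderC e_orth e01 N : self_adjoint (remainder e N).
have r0 : remainder e N 0 = 0 by have := self_adjointZ 0 0 rs; rewrite !scale0r.
rewrite /S self_adjointZ//.
rewrite (big_morph (remainder e N) (fun u v => self_adjointD u v rs) r0).
under eq_bigr do rewrite self_adjointZ//.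
exact: normr_mean_sqr.
Qed.

(** The class enters only through the bound [C] on squared norms and through containing 0. *)
Lemma local_rademacher_le (J : V -> V) (lambda : nat -> R) (F : set (V -> R))
    (r C : R) : covariance_operator P x J -> eigenvalue_sequence J lambda ->
  0 < r -> 0 < C -> F (linear_function 0) ->
  (forall w, F (linear_function w) -> `|w| ^+ 2 <= C) ->
  (local_rademacher P x xs (fun i => sigma i) F r <=
   sqrte ((2 / n%:R)%:E * \sum_(0 <= j <oo) (Num.min r (C * lambda j))%:E))%E.
Proof.
move=> J_cov lambda_eig r0 C0 F0 FC.
have Jinner u v : (inner (J u) v)%:E =
    (\int[P]_omega (inner (x omega) u * inner (x omega) v)%:E)%E.
  by rewrite J_cov unlock; apply: eq_integral => w _; rewrite innerZl.
have Js : self_adjoint J.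
  move=> u v; rewrite [RHS]innerC; apply: EFin_inj; rewrite !Jinner.
  by apply: eq_integral => w _; rewrite mulrC.
have Jx v : (inner (J v) v)%:E = (\int[P]_omega (inner v (x omega) ^+ 2)%:E)%E.
  by rewrite Jinner; apply: eq_integral => w _; rewrite expr2 innerC.
have Jp : positive J.
  by move=> v; rewrite -lee_fin Jx; apply: integral_ge0 => w _; rewrite lee_fin sqr_ge0.
have [e [mu [e_orth emu Je J_top]]] := spectral_sequence xm x2 Js Jx.
have e01 j : e j = 0 \/ `|e j| = 1 by case: (emu j) => -[]; [left|right].
pose f t := Num.min r (C * t).
have f_ge0 t : 0 <= t -> 0 <= f t by move=> t0; rewrite le_min (ltW r0) mulr_ge0// ltW.
have f0 : f 0 = 0 by rewrite /f mulr0 min_r// ltW.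
have lambda0 j : 0 <= lambda j := eigenvalue_sequence_ge0 Jp lambda_eig j.
have fmu N := orthogonal_eigenvalues_le Jp lambda_eig N e_orth emu Je f0 f_ge0.
have : (0 <= \sum_(0 <= j <oo) (f (lambda j))%:E)%E.
  by apply: nneseries_ge0 => j _ _; rewrite lee_fin f_ge0.
rewrite -/(f _); move: fmu; set B := (\sum_(0 <= j <oo) _)%E.
(* An infinite series makes the bound trivial. *)
case: B => [b| |//] fmu b0; last first.
  by rewrite gt0_muley ?leey// lte_fin divr_gt0.
pose tau N := (\int[P]_omega (`|remainder e N (x omega)| ^+ 2)%:E)%E.
have [_ x_sep] := x_random.
have tau0 : tau @ \oo --> 0%E :=
  remainder_expectation_cvg0 xm x2 Jx e_orth emu Je J_top x_sep.
set L := local_rademacher _ _ _ _ _ _.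
have L_N c N : 0 < c ->
    (L <= (c / 2 + c^-1 * (n%:R^-1 * b))%:E + (c^-1 * C)%:E * tau N)%E.
  move=> c0.
  pose Z omega := \sum_(j < N) cutoff mu r C j * inner (S omega) (e j) ^+ 2.
  pose W omega := n%:R^-1 * \sum_i `|sigma i omega *: remainder e N (xs i omega)| ^+ 2.
  have Z0 omega : 0 <= Z omega.
    apply: sumr_ge0 => j _; apply: mulr_ge0; last exact: sqr_ge0.
    exact: (cutoff_ge0 emu).
  have W0 omega : 0 <= W omega.
    by rewrite mulr_ge0 ?invr_ge0// sumr_ge0// => i _; exact: sqr_ge0.
  have mZ : measurable_fun setT Z.
    apply: measurable_sum => j; apply: measurable_funM; first exact: measurable_cst.
    by apply: measurable_funX; exact: measurable_inner_sample.
  have mW : measurable_fun setT W.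
    apply: measurable_funM; first exact: measurable_cst.
    apply: measurable_sum => i; exact: measurable_signed_remainder.
  have EZ : (\int[P]_omega (Z omega)%:E <= (n%:R^-1 * b)%:E)%E.
    under eq_integral do rewrite -sumEFin.
    rewrite ge0_integral_sum//; last 2 first.
    - move=> j; apply/measurable_EFinP.
      apply: measurable_funM; first exact: measurable_cst.
      by apply: measurable_funX; exact: measurable_inner_sample.
    - by move=> j w _; rewrite lee_fin mulr_ge0 ?sqr_ge0//; exact: (cutoff_ge0 emu).
    have cutE j : (\int[P]_omega (cutoff mu r C j * inner (S omega) (e j) ^+ 2)%:E =
        (n%:R^-1 * f (mu j))%:E)%E.
      under eq_integral do rewrite EFinM.
      rewrite ge0_integralZl_EFin//; last 3 first.
      - by move=> w _; rewrite lee_fin sqr_ge0.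
      - apply/measurable_EFinP; apply: measurable_funX; exact: measurable_inner_sample.
      - exact: (cutoff_ge0 emu).
      rewrite integral_inner_sample_sqr -Jx -!EFinM Je innerZl inner_normE /f.
      rewrite -(cutoff_eigenvalue emu j r0 C0) mulrCA; congr (_ * (_ * _))%:E.
      case: (emu j) => [[-> _]|[_ ->]]; first by rewrite mul0r.
      by rewrite expr1n mulr1.
    under eq_bigr do rewrite cutE.
    rewrite sumEFin -mulr_sumr lee_fin ler_pM2l ?invr_gt0//.
    by rewrite -lee_fin; exact: fmu.
  have EW : (\int[P]_omega (W omega)%:E = tau N)%E by exact: integral_remainder_sample.
  apply: (@le_trans _ _
    (\int[P]_omega ((c / 2)%:E + (c^-1)%:E * ((Z omega)%:E + C%:E * (W omega)%:E)))%E).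
    (* The zero vector is admissible, so the supremum is nonnegative, as this comparison of
       integrals requires. *)
    apply: le_nonmeasurable_integral => omega.
      apply: ereal_sup_ubound; exists 0; last by rewrite inner0l.
      split=> //; rewrite unlock integral0_eq ?lee_fin ?ltW// => w _.
      by rewrite /linear_function inner0l expr0n.
    apply: ge_ereal_sup => _ [w [Fw wr] <-].
    rewrite [leRHS](_ : _ = (c / 2 + c^-1 * (Z omega + C * W omega))%:E)// lee_fin.
    have {}wr : inner (J w) w <= r.
      by rewrite -lee_fin Jx; move: wr; rewrite unlock.
    have wr' := le_trans (quadratic_form_ge e_orth e01 Js Jp Je N w) wr.
    apply: le_trans (inner_le_weighted e_orth emu _ r0 C0 c0 (FC _ Fw) wr') _.
    rewrite lerD2l ler_pM2l ?invr_gt0// lerD2l ler_pM2l//.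
    exact: normr_remainder_sample.
  have mCW : measurable_fun setT (fun omega => C%:E * (W omega)%:E)%E.
    by apply: measurable_funeM; exact/measurable_EFinP.
  have mZCW : measurable_fun setT (fun omega => (Z omega)%:E + C%:E * (W omega)%:E)%E.
    by apply: emeasurable_funD => //; exact/measurable_EFinP.
  have CW0 omega : (0 <= C%:E * (W omega)%:E)%E by rewrite mule_ge0 ?lee_fin// ltW.
  have ZCW0 omega : (0 <= (Z omega)%:E + C%:E * (W omega)%:E)%E.
    by apply: adde_ge0; [rewrite lee_fin; exact: Z0|exact: CW0].
  have cV0 : 0 <= c^-1 by rewrite invr_ge0 ltW.
  rewrite ge0_integralD//; last 3 first.
  - by move=> w _; rewrite lee_fin divr_ge0// ltW.
  - by move=> w _; rewrite mule_ge0.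
  - exact: measurable_funeM.
  rewrite [X in (X + _ <= _)%E](_ : _ = (c / 2)%:E); last first.
    by have := @expectation_cst _ _ _ P (c / 2); rewrite unlock.
  rewrite ge0_integralZl_EFin//.
  rewrite ge0_integralD//; [|by move=> w _; rewrite lee_fin|exact/measurable_EFinP].
  rewrite ge0_integralZl_EFin//;
    [|by move=> w _; rewrite lee_fin|exact/measurable_EFinP|exact: ltW].
  have tau_ge0 : (0 <= tau N)%E.
    by apply: integral_ge0 => w _; rewrite lee_fin sqr_ge0.
  rewrite EW ge0_muleDr//; last 2 first.
  - by apply: integral_ge0 => w _; rewrite lee_fin.
  - by rewrite mule_ge0// lee_fin ltW.
  rewrite muleA -EFinM EFinD -addeA.
  apply: leeD => //; apply: leeD => //; rewrite EFinM.
  by apply: lee_wpmul2l.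
(* Letting [N] tend to infinity removes the cost [tau N] of the truncation. *)
have L_c c : 0 < c -> (L <= (c / 2 + c^-1 * (n%:R^-1 * b))%:E)%E.
  move=> c0; have lim :
      (fun N => (c / 2 + c^-1 * (n%:R^-1 * b))%:E + (c^-1 * C)%:E * tau N)%E
      @ \oo --> ((c / 2 + c^-1 * (n%:R^-1 * b))%:E + (c^-1 * C)%:E * 0)%E.
    by apply: cvgeD; [|exact: cvg_cst|apply: cvgeZl]; rewrite ?mule0.
  rewrite -[leRHS]adde0 -(mule0 (c^-1 * C)%:E) -(cvg_lim _ lim)//.
  by apply: lime_ge; [exact: cvgP lim|apply: nearW => N; exact: L_N].
rewrite -EFinM /=; set a := 2 / n%:R * b.
have a0 : 0 <= a by rewrite mulr_ge0 ?divr_ge0.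
have aE : n%:R^-1 * b = a / 2 by rewrite /a; field; rewrite gt_eqF.
(* For [a = 0] the optimal [c] would be 0, so [c = 2 eps] is used with [eps] arbitrarily small. *)
have [a00|an0] := eqVneq a 0.
  rewrite a00 sqrtr0; apply/lee_addgt0Pr => eps eps0; rewrite add0e.
  apply: le_trans (L_c (2 * eps) _) _; first by rewrite mulr_gt0.
  by rewrite aE a00 mul0r mulr0 addr0 lee_fin; lra.
(* The choice [c = sqrt a] minimizes [c / 2 + a / (2 c)], with value [sqrt a]. *)
have : 0 < Num.sqrt a by rewrite sqrtr_gt0 lt_def an0.
have := sqr_sqrtr a0; move: (Num.sqrt a) => s sE s0.
apply: le_trans (L_c _ s0) _; rewrite lee_fin aE -sE.
by rewrite le_eqVlt; apply/orP; left; apply/eqP; field; rewrite gt_eqF.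
Qed.

End local_rademacher_bound.

Theorem theorem6 (R : realType) (M n : nat) (M_gt0 : (0 < M)%N) (n_gt0 : (0 < n)%N)
    (H : 'I_M -> hilbertType R)
    (d : measure_display) (Omega : measurableType d) (P : probability Omega R)
    (x : Omega -> hprod H)
    (x_random : random_element P x)
    (x_L2 : ('E_P[fun omega => (`|x omega| ^+ 2)%R] < +oo)%E)
    (xs : 'I_n -> Omega -> hprod H)
    (xs_random : forall i, random_element P (xs i))
    (xs_law : forall i, identically_distributed P (xs i) x)
    (sigma : 'I_n -> {RV P >-> R})
    (sigma_law : forall i, rademacher P (sigma i))
    (indep : independent_sample_signs P xs (fun i => sigma i))
    (J : hprod H -> hprod H) (J_cov : covariance_operator P x J)
    (lambda : nat -> R) (lambda_eig : eigenvalue_sequence J lambda)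
    (p : \bar R) (pstar : R) (p_ge2 : (2%:E <= p)%E)
    (pstar_conj : (p^-1 + (pstar%:E)^-1 = 1)%E)
    (D r : R) (D_gt0 : 0 < D) (r_gt0 : 0 < r) :
  (local_rademacher P x xs (fun i => sigma i) (mkl_class p D) r <=
   sqrte ((2 / n%:R)%:E *
     \sum_(0 <= j <oo)
       (Num.min r (D ^+ 2 * M%:R `^ (2 / pstar - 1) * lambda j))%:E))%E.
Proof.
have C0 : 0 < D ^+ 2 * M%:R `^ (2 / pstar - 1).
  by rewrite mulr_gt0 ?exprn_gt0// powR_gt0// ltr0n.
apply: (local_rademacher_le n_gt0 x_random x_L2 xs_random xs_law sigma_law indep
  J_cov lambda_eig r_gt0 C0).
  exists 0 => //=; rewrite /mixed_norm.
  case: p p_ge2 {pstar_conj} => [p| |//] p2 /=.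
    rewrite big1 ?powR0 ?(ltW D_gt0)//.
      by rewrite gt_eqF// invr_gt0; move: p2; rewrite lee_fin; lra.
    move=> m _; rewrite [X in `|X|]normr0 normr0 powR0// gt_eqF//.
    by move: p2; rewrite lee_fin; lra.
  by apply: bigmax_le => [|m _]; rewrite ?normr_id ?normr0 ltW.
(* The class consists of functions, but a linear function determines its vector, so the norm
   constraint on [w'] passes to [w]. *)
move=> w [w' /= w'D w'w]; have -> : w = w'.
  by apply: inner_inj => u; rewrite -[RHS]/(linear_function w' u) w'w.
exact: mixed_norm_bound w'D.
Qed.
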